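(* Let $r\in\mathbb{N}$. For each $j\in\{1,\ldots,r\}$ let $\Gamma_j\subset \mathrm{PSL}_2(\mathbb{R})$ be a Fuchsian Schottky group with a fixed choice of Schottky data (disks $\mathcal{D}_{j,k}$, side-pairing elements $g_{j,k}$, geodesic sides $s_{j,k}$ and forward intervals $I_{j,k}$, $k\in\mathcal{I}_j$, as described in the context), and let $L_j\subseteq P^1_{\mathbb{R}}$ be the limit set of $\Gamma_j$. Let $G=\mathrm{PSL}_2(\mathbb{R})^r$, $\Gamma=\Gamma_1\times\cdots\times\Gamma_r$, $\mathcal{J}=\prod_{j=1}^r\mathcal{I}_j$, and let $C_{\mathrm{st},j}$ and $C_{\mathrm{st}}=\prod_{j=1}^rC_{\mathrm{st},j}$ be the sets of representatives for the strong cross sections $\widehat{C}_{\mathrm{st},j}$ and $\widehat{C}_{\mathrm{st}}$ described in the context. For $j\in\{1,\ldots,r\}$ and $k\in\mathcal{I}_j$ let $I^c_{\mathrm{st},j,k}=L_j\cap(P^1_{\mathbb{R}}\setminus I_{j,k})$. For $m=(m_1,\ldots,m_r)\in\mathcal{J}$ set $$I^c_{\mathrm{st},m}=\prod_{j=1}^rI^c_{\mathrm{st},j,m_j},\qquad g_m=(g_{1,m_1},\ldots,g_{r,m_r})\in\Gamma,$$ let $D=\bigcup_{m\in\mathcal{J}}I^c_{\mathrm{st},m}\subseteq(P^1_{\mathbb{R}})^r$, and define $F\colon D\to D$ by $F(x)=g_m(x)$ for $x\in I^c_{\mathrm{st},m}$, $m\in\mathcal{J}$. For $j\in\{1,\ldots,r\}$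 let $F_j\colon L_j\to L_j$ denote the discrete dynamical system on $P^1_{\mathbb{R}}$ induced by $C_{\mathrm{st},j}$ (for the geodesic flow on $\Gamma_j\backslash\mathbb{H}$). Then: (i) The map $F$ is the discrete dynamical system on the Furstenberg boundary $(P^1_{\mathbb{R}})^r$ that is induced by $C_{\mathrm{st}}$. (ii) For any $m=(m_1,\ldots,m_r)\in\mathcal{J}$ we have $$F|_{I^c_{\mathrm{st},m}}=\bigl(F_1|_{I^c_{\mathrm{st},1,m_1}},\ldots,F_r|_{I^c_{\mathrm{st},r,m_r}}\bigr).$$
   Context: Schottky data. $\mathbb{H}=\{z\in\mathbb{C}\mid \operatorname{Im} z>0\}$ is the hyperbolic plane, on which $\mathrm{PSL}_2(\mathbb{R})$ acts by fractional linear transformations; the action extends to $P^1_{\mathbb{R}}=\mathbb{R}\cup\{\infty\}$. A (Fuchsian) Schottky group arises as follows. For $q\in\mathbb{N}$ choose $2q$ pairwise disjoint closed Euclidean disks $\mathcal{D}_1,\mathcal{D}_{-1},\ldots,\mathcal{D}_q,\mathcal{D}_{-q}$ in $\mathbb{C}$ (of positive radius) centered in $\mathbb{R}$. For $k\in\{1,\ldots,q\}$ pick $g_k\in\mathrm{PSL}_2(\mathbb{R})$ mapping the exterior of $\mathcal{D}_k$ (in the Riemann sphere) onto the interior of $\mathcal{D}_{-k}$, and set $g_{-k}=g_k^{-1}$. The Schottky group is $\langle g_1,\ldots,g_q\rangle$. Put $\mathcal{I}=\{\pm1,\ldots,\pm q\}$. For $k\in\mathcal{I}$ let $s_k$ be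 the boundary of $\mathcal{D}_k$ in $\mathbb{H}$ (a geodesic) and let the forward interval $I_k=P^1_{\mathbb{R}}\setminus\mathcal{D}_k$ be the part of $P^1_{\mathbb{R}}$ exterior to $\mathcal{D}_k$. For the group $\Gamma_j$ all these objects carry an additional index $j$. The limit set $L_j$ is the set of limit points in $P^1_{\mathbb{R}}$ of the orbit $\Gamma_j(z)$, for any $z\in\mathbb{H}$; it is the disjoint union of the sets $I^c_{\mathrm{st},j,k}$, $k\in\mathcal{I}_j$. Weyl chamber flow. $G=\mathrm{PSL}_2(\mathbb{R})^r$ acts componentwise on $\mathbb{X}=\mathbb{H}^r$ and on its Furstenberg boundary $(P^1_{\mathbb{R}})^r$. Let $\mathbb{Y}=\Gamma\backslash\mathbb{X}$. For $t\in\mathbb{R}$ let $a_t\in\mathrm{PSL}_2(\mathbb{R})$ be the class of $\mathrm{diag}(e^{t/2},e^{-t/2})$; for $t=(t_1,\ldots,t_r)\in\mathbb{R}^r$ put $a_t=(a_{t_1},\ldots,a_{t_r})$, and let $A=\{a_t\mid t\in\mathbb{R}^r\}$. The Weyl chambers of $\mathbb{X}$ are identified with $G$ and the Weyl chambers of $\mathbb{Y}$ with $\Gamma\backslash G=\prod_{j=1}^r\Gamma_j\backslash\mathrm{PSL}_2(\mathbb{R})$; the Weyl chamber flow on $\mathbb{Y}$ is the action $(a,\Gamma g)\mapsto\Gamma ga$ of $A$ on $\Gamma\backslash G$ (for $r=1$ this is the geodesic flow). The positive Weyl chamber is $A^+=\{a_t\mid t\in(\mathbb{R}_{>0})^r\}$.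 The projection of Weyl chambers to the Furstenberg boundary is $\nu\colon G\to(P^1_{\mathbb{R}})^r$, $\nu(g_1,\ldots,g_r)=(g_1(\infty),\ldots,g_r(\infty))$. The quotient map is $\pi^\Gamma\colon G\to\Gamma\backslash G$. The sets $C$ and $C_{\mathrm{st}}$. For $j\in\{1,\ldots,r\}$ set $$C_j=\bigcup_{k\in\mathcal{I}_j}\{g\in\mathrm{PSL}_2(\mathbb{R})\mid g(i)\in s_{j,k},\ g(\infty)\in I_{j,k}\},\qquad C_{\mathrm{st},j}=\{g\in C_j\mid g(\infty)\in L_j\},$$ and let $\widehat{C}_j,\widehat{C}_{\mathrm{st},j}$ be their images in $\Gamma_j\backslash\mathrm{PSL}_2(\mathbb{R})$. Set $C=\prod_jC_j$, $\widehat{C}=\prod_j\widehat{C}_j$, $C_{\mathrm{st}}=\prod_jC_{\mathrm{st},j}$, $\widehat{C}_{\mathrm{st}}=\prod_j\widehat{C}_{\mathrm{st},j}$. It is known that $\widehat{C}$ is a cross section for the Weyl chamber flow on $\mathbb{Y}$ with set of representatives $C$ (meaning that $\pi^\Gamma$ restricts to a bijection $C\to\widehat{C}$), and that $\widehat{C}_{\mathrm{st}}$ is the strong cross section contained in $\widehat{C}$ with set of representatives $C_{\mathrm{st}}$; here ''strong'' means that $\widehat{C}_{\mathrm{st}}$ is a cross section and is the set of all $\widehat{v}\in\widehat{C}$ for which all iterates $\widehat{R}^n(\widehat{v})$, $n\in\mathbb{N}$, of the first return map $\widehat{R}$ (defined next) exist. First return map. For $\Gamma g\in\widehat{C}$ put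 $T=\{t\in(\mathbb{R}_{>0})^r\mid\Gamma ga_t\in\widehat{C}\}$ and let $T_j$ be the projection of $T$ to the $j$-th coordinate. If $T\neq\emptyset$, $\Gamma g$ has a next intersection with $\widehat{C}$ if $t_{0,j}=\min T_j$ exists for all $j$, $t_0=(t_{0,1},\ldots,t_{0,r})\in(\mathbb{R}_{>0})^r$ and $\Gamma ga_{t_0}\in\widehat{C}$. The first return map $\widehat{R}$ is defined on the set of $\Gamma g\in\widehat{C}$ having a next intersection by $\widehat{R}(\Gamma g)=\Gamma ga_{t_0}$. It restricts to a self-map $\widehat{R}\colon\widehat{C}_{\mathrm{st}}\to\widehat{C}_{\mathrm{st}}$. Let $R\colon C_{\mathrm{st}}\to C_{\mathrm{st}}$ be the unique map with $\pi^\Gamma\circ R=\widehat{R}\circ\pi^\Gamma$ on $C_{\mathrm{st}}$. Induced discrete dynamical system. The discrete dynamical system on the Furstenberg boundary induced by $C_{\mathrm{st}}$ is the (necessarily unique, if it exists) map $\Phi\colon\nu(C_{\mathrm{st}})\to\nu(C_{\mathrm{st}})$ such that $\Phi\circ\nu=\nu\circ R$ on $C_{\mathrm{st}}$. Thus statement (i) asserts that $D=\nu(C_{\mathrm{st}})$ and $F\circ\nu=\nu\circ R$ on $C_{\mathrm{st}}$. The map $F_j\colon L_j\to L_j$, $L_j=\nu(C_{\mathrm{st},j})$, is the induced discrete dynamical system obtained from the same definitions applied to the single factor $\Gamma_j$ (i.e., with $r=1$, $\Gamma=\Gamma_j$, and $C_j$, $C_{\mathrm{st},j}$ in place of $C$,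 $C_{\mathrm{st}}$). *)

(* Defs.v *)
From HB Require Import structures.
From mathcomp Require Import all_boot all_order all_algebra generic_quotient.
From mathcomp Require Import all_classical all_reals all_analysis.
From mathcomp Require Import ring.
From mathcomp.real_closed Require Export complex.

Set Implicit Arguments.
Unset Strict Implicit.
Unset Printing Implicit Defensive.

Import Order.TTheory GRing.Theory Num.Theory.
Import numFieldNormedType.Exports.

Local Open Scope classical_set_scope.
Local Open Scope quotient_scope.
Local Open Scope complex_scope.
Local Open Scope ring_scope.

(** * [PSL_2(R)] *)

Section SL2.
Context (R : realType).

Record SL2 := MkSL2 { sl2_mx :> 'M[R]_2; sl2_det : \det sl2_mx == 1 }.

HB.instance Definition _ := [isSub for sl2_mx].
HB.instance Definition _ := [Choice of SL2 by <:].

Lemma sl2_detE (A : SL2) : \det A = 1. Proof. exact/eqP/sl2_det. Qed.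

Lemma sl2_unit (A : SL2) : (A : 'M[R]_2) \is a GRing.unit.
Proof.
have : (A : 'M[R]_2) \in unitmx by rewrite unitmxE sl2_detE unitr1.
by [].
Qed.

Fact sl2_mul_subproof (A B : SL2) : \det ((A : 'M[R]_2) * B) == 1.
Proof. by rewrite [X in \det X]/GRing.mul/= det_mulmx !sl2_detE mulr1. Qed.
Definition sl2_mul A B := MkSL2 (sl2_mul_subproof A B).

Fact sl2_one_subproof : \det (1 : 'M[R]_2) == 1.
Proof. by rewrite det1. Qed.
Definition sl2_one := MkSL2 sl2_one_subproof.

Fact sl2_inv_subproof (A : SL2) : \det ((A : 'M[R]_2)^-1) == 1.
Proof. by rewrite det_inv sl2_detE invr1. Qed.
Definition sl2_inv A := MkSL2 (sl2_inv_subproof A).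

Fact sl2_mulA : associative sl2_mul.
Proof. by move=> A B C; apply/val_inj; rewrite /= mulrA. Qed.
Fact sl2_mul1 : left_id sl2_one sl2_mul.
Proof. by move=> A; apply/val_inj; rewrite /= mul1r. Qed.
Fact sl2_mulr1 : right_id sl2_one sl2_mul.
Proof. by move=> A; apply/val_inj; rewrite /= mulr1. Qed.
Fact sl2_mulV : left_inverse sl2_one sl2_inv sl2_mul.
Proof. by move=> A; apply/val_inj; rewrite /= mulVr ?sl2_unit. Qed.
Fact sl2_mulrV : right_inverse sl2_one sl2_inv sl2_mul.
Proof. by move=> A; apply/val_inj; rewrite /= mulrV ?sl2_unit. Qed.

HB.instance Definition _ :=
  isGroup.Build SL2 sl2_mulA sl2_mul1 sl2_mulr1 sl2_mulV sl2_mulrV.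

Definition sl2_eqpm (A B : SL2) :=
  ((A : 'M[R]_2) == B) || ((A : 'M[R]_2) == - (B : 'M[R]_2)).

Fact sl2_eqpm_refl : reflexive sl2_eqpm.
Proof. by move=> A; rewrite /sl2_eqpm eqxx. Qed.
Fact sl2_eqpm_sym : symmetric sl2_eqpm.
Proof. by move=> A B; rewrite /sl2_eqpm eq_sym -eqr_oppLR [- _ == _]eq_sym. Qed.
Fact sl2_eqpm_trans : transitive sl2_eqpm.
Proof.
move=> B A C; rewrite /sl2_eqpm.
by move=> /orP[/eqP->|/eqP->] /orP[/eqP->|/eqP->]; rewrite ?opprK eqxx ?orbT.
Qed.

Canonical sl2_eqpm_equiv :=
  EquivRel sl2_eqpm sl2_eqpm_refl sl2_eqpm_sym sl2_eqpm_trans.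

Definition PSL2 := {eq_quot sl2_eqpm}.

HB.instance Definition _ := Choice.on PSL2.
HB.instance Definition _ := EqQuotient.on PSL2.

Lemma psl2_eqP (A B : SL2) :
  reflect ((A : 'M[R]_2) = B \/ (A : 'M[R]_2) = - (B : 'M[R]_2))
    (\pi_PSL2 A == \pi_PSL2 B).
Proof.
rewrite piE.
by apply: (iffP orP) => -[/eqP|/eqP]; [left|right|left|right].
Qed.

Definition psl2_mul := lift_op2 PSL2 sl2_mul.
Definition psl2_one : PSL2 := \pi sl2_one.
Definition psl2_inv := lift_op1 PSL2 sl2_inv.

Lemma psl2_mulE : {morph \pi : A B / sl2_mul A B >-> psl2_mul A B}.
Proof.
unlock psl2_mul => A B; apply/eqP/psl2_eqP => /=.
have /eqP/psl2_eqP := reprK (\pi_PSL2 A).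
have /eqP/psl2_eqP := reprK (\pi_PSL2 B).
by move=> [->|->] [->|->]; rewrite ?mulNr ?mulrN ?opprK; [left|right|right|left].
Qed.

Lemma psl2_invE : {morph \pi : A / sl2_inv A >-> psl2_inv A}.
Proof.
unlock psl2_inv => A; apply/eqP/psl2_eqP => /=.
have /eqP/psl2_eqP := reprK (\pi_PSL2 A).
by move=> [->|->]; rewrite ?invrN ?opprK; [left|right].
Qed.

Canonical pi_psl2_mul_morph := PiMorph2 psl2_mulE.
Canonical pi_psl2_inv_morph := PiMorph1 psl2_invE.

Fact psl2_mulA : associative psl2_mul.
Proof.
by elim/quotW=> A; elim/quotW=> B; elim/quotW=> C; rewrite !piE sl2_mulA.
Qed.
Fact psl2_mul1 : left_id psl2_one psl2_mul.
Proof. by elim/quotW=> A; rewrite /psl2_one !piE sl2_mul1. Qed.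
Fact psl2_mulr1 : right_id psl2_one psl2_mul.
Proof. by elim/quotW=> A; rewrite /psl2_one !piE sl2_mulr1. Qed.
Fact psl2_mulV : left_inverse psl2_one psl2_inv psl2_mul.
Proof. by elim/quotW=> A; rewrite /psl2_one !piE sl2_mulV. Qed.
Fact psl2_mulrV : right_inverse psl2_one psl2_inv psl2_mul.
Proof. by elim/quotW=> A; rewrite /psl2_one !piE sl2_mulrV. Qed.

HB.instance Definition _ :=
  isGroup.Build PSL2 psl2_mulA psl2_mul1 psl2_mulr1 psl2_mulV psl2_mulrV.

End SL2.

(** * Fractional linear transformations *)

(** The projective line over [F]; [None] is the point at infinity. *)
Definition mobius (F : fieldType) (M : 'M[F]_2)
    (x : one_point_compactification F) : one_point_compactification F :=
  match x with
  | Some z => if M 1 0 * z + M 1 1 == 0 then None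
              else Some ((M 0 0 * z + M 0 1) / (M 1 0 * z + M 1 1))
  | None => if M 1 0 == 0 then None else Some (M 0 0 / M 1 0)
  end.

Lemma mobiusN (F : fieldType) (M : 'M[F]_2) x : mobius (- M) x = mobius M x.
Proof.
case: x => [z|] /=; rewrite !mxE ?mulNr -?opprD oppr_eq0 ?mulNr;
  by rewrite invrN mulrN opprK.
Qed.

Lemma mobiusM (F : fieldType) (A B : 'M[F]_2) x :
  \det A != 0 -> \det B != 0 -> mobius (A *m B) x = mobius A (mobius B x).
Proof.
have E (M : 'M[F]_2) : \det M = M 0 0 * M 1 1 - M 0 1 * M 1 0.
  rewrite (expand_det_row _ ord0) !big_ord_recl big_ord0 addr0 /cofactor !det_mx11 !mxE /=.
  rewrite expr0 expr1 mul1r mulN1r mulrN.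
  by congr (M _ _ * M _ _ - M _ _ * M _ _); apply/val_inj.
have P (i j : 'I_2) : (A *m B) i j = A i 0 * B 0 j + A i 1 * B 1 j.
  rewrite mxE !big_ord_recl big_ord0 addr0.
  by congr (A _ _ * B _ _ + A _ _ * B _ _); apply/val_inj.
rewrite !E => dA dB.
set a := A 0 0 in dA *; set b := A 0 1 in dA *; set c := A 1 0 in dA *; set d := A 1 1 in dA *.
set a' := B 0 0 in dB *; set b' := B 0 1 in dB *; set c' := B 1 0 in dB *; set d' := B 1 1 in dB *.
case: x => [z|] /=; rewrite !P -/a -/b -/c -/d -/a' -/b' -/c' -/d'.
  have -> : (c * a' + d * c') * z + (c * b' + d * d') = c * (a' * z + b') + d * (c' * z + d') by ring.
  have -> : (a * a' + b * c') * z + (a * b' + b * d') = a * (a' * z + b') + b * (c' * z + d') by ring.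
  case: eqVneq => e1.
    case: (eqVneq (c' * z + d')) => e2 /=; rewrite -/c -/d -/a -/b.
      case: eqVneq => // e3; exfalso; move: e1; rewrite e2 mulr0 addr0.
      move/eqP; rewrite mulf_eq0 (negPf e3) /= => /eqP e4.
      have: (a' * d' - b' * c') = a' * (c' * z + d') - c' * (a' * z + b') by ring.
      by rewrite e2 e4 !mulr0 subrr => e5; rewrite e5 eqxx in dB.
    case: eqVneq => // /eqP []; move: e1 => /(congr1 (fun u => u / (c' * z + d'))).
    by rewrite mul0r mulrDl mulfK // mulrA => ->.
  case: (eqVneq (c' * z + d')) => e2 /=; rewrite -/c -/d -/a -/b.
    move: e1; rewrite e2 !mulr0 !addr0 mulf_eq0 negb_or => /andP[/negPf-> e4].
    by rewrite -mulf_div divff // mulr1.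
  have -> : c * ((a' * z + b') / (c' * z + d')) + d = (c * (a' * z + b') + d * (c' * z + d')) / (c' * z + d').
    by rewrite [in RHS]mulrDl mulfK // mulrA.
  have -> : a * ((a' * z + b') / (c' * z + d')) + b = (a * (a' * z + b') + b * (c' * z + d')) / (c' * z + d').
    by rewrite [in RHS]mulrDl mulfK // mulrA.
  by rewrite mulf_eq0 invr_eq0 (negPf e1) (negPf e2) /= -mulf_div divff ?mulr1 ?invr_neq0.
case: (eqVneq c' 0) => e2 /=; rewrite -/c -/d -/a -/b.
  have a0 : a' != 0 by apply: contra_neq dB => ->; rewrite e2 mul0r mulr0 subrr.
  rewrite e2 !mulr0 !addr0 mulf_eq0 (negPf a0) orbF; case: eqVneq => // _.
  by rewrite -mulf_div divff // mulr1.
have -> : c * (a' / c') + d = (c * a' + d * c') / c' by rewrite [RHS]mulrDl mulfK // mulrA.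
have -> : a * (a' / c') + b = (a * a' + b * c') / c' by rewrite [RHS]mulrDl mulfK // mulrA.
rewrite mulf_eq0 invr_eq0 (negPf e2) orbF; case: eqVneq => // e1.
by rewrite -mulf_div divff ?mulr1 ?invr_neq0.
Qed.

Definition P1 (R : realType) := one_point_compactification R.

Definition sphere (R : realType) :=
  one_point_compactification (R[i] : numFieldType).

Definition P1_sphere (R : realType) (x : P1 R) : sphere R :=
  omap (real_complex R) x.

Definition P1_act (R : realType) (g : PSL2 R) (x : P1 R) : P1 R :=
  mobius (repr g : SL2 R) x.

Definition sphere_act (R : realType) (g : PSL2 R) (x : sphere R) : sphere R :=
  mobius (map_mx (real_complex R) (repr g : SL2 R)) x.

Lemma P1_actE (R : realType) (A : SL2 R) x :
  P1_act (\pi_(PSL2 R) A) x = mobius A x.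
Proof.
rewrite /P1_act; have /eqP/psl2_eqP[->//|->] := reprK (\pi_(PSL2 R) A).
exact: mobiusN.
Qed.

Lemma sphere_actE (R : realType) (A : SL2 R) x :
  sphere_act (\pi_(PSL2 R) A) x = mobius (map_mx (real_complex R) A) x.
Proof.
rewrite /sphere_act; have /eqP/psl2_eqP[->//|->] := reprK (\pi_(PSL2 R) A).
by rewrite map_mxN mobiusN.
Qed.

Lemma P1_sphere_act (R : realType) (g : PSL2 R) x :
  P1_sphere (P1_act g x) = sphere_act g (P1_sphere x).
Proof.
rewrite /P1_act /sphere_act; case: x => [z|] /=; rewrite !mxE.
  rewrite -rmorphM -rmorphD fmorph_eq0; case: ifP => //= _.
  by rewrite fmorph_div rmorphD rmorphM.
by rewrite fmorph_eq0; case: ifP => //= _; rewrite fmorph_div.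
Qed.

Fact geo_subproof (R : realType) (t : R) :
  \det (diag_mx (\row_(j < 2) if j == 0 then expR (t / 2)
                              else expR (- (t / 2)))) == 1.
Proof. by rewrite det_diag !big_ord_recl big_ord0 !mxE/= mulr1 -expRD subrr expR0. Qed.

Definition geo (R : realType) (t : R) : PSL2 R :=
  \pi_(PSL2 R) (MkSL2 (geo_subproof t)).

(** * Schottky data *)

Definition closed_disk (R : realType) (c r : R) : set (sphere R) :=
  Some @` [set z : R[i] | `|z - c%:C| <= r%:C].

Definition open_disk (R : realType) (c r : R) : set (sphere R) :=
  Some @` [set z : R[i] | `|z - c%:C| < r%:C].

(** The index [(k, true)] stands for [k + 1] and [(k, false)] for
    [- (k + 1)]. *)
Record schottky (R : realType) := Schottky {
  schottky_rank : nat;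
  center : 'I_schottky_rank * bool -> R;
  radius : 'I_schottky_rank * bool -> R;
  radius_gt0 : forall k, 0 < radius k;
  disks_disjoint :
    trivIset setT (fun k => closed_disk (center k) (radius k));
  pairing : 'I_schottky_rank -> PSL2 R;
  pairingP : forall k : 'I_schottky_rank,
    sphere_act (pairing k)
      @` (~` closed_disk (center (k, true)) (radius (k, true)))
    = open_disk (center (k, false)) (radius (k, false))
}.

Section OneFactor.
Context (R : realType) (S : schottky R).

Definition side_index : finType := ('I_(schottky_rank S) * bool)%type.

Definition disk (k : side_index) : set (sphere R) :=
  closed_disk (center k) (radius k).

Definition gen (k : side_index) : PSL2 R :=
  if k.2 then pairing k.1 else (pairing k.1)^-1%g.

Definition side (k : side_index) : set (sphere R) :=
  Some @` [set z : R[i] | 0 < complex.Im z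
                          /\ `|z - (center k)%:C| = (radius k)%:C].

Definition forward (k : side_index) : set (P1 R) :=
  [set x | ~ disk k (P1_sphere x)].

Definition is_subgroup (gT : groupType) (H : set gT) :=
  H 1%g /\ forall x y, H x -> H y -> H (x / y)%g.

Definition schottky_group : set (PSL2 R) :=
  smallest (@is_subgroup (PSL2 R)) (range (@pairing R S)).

(** The set of limit points of an orbit in the upper half-plane does not
    depend on the orbit. *)
Definition limit_set : set (P1 R) :=
  [set x | forall z : R[i], 0 < complex.Im z ->
     limit_point [set sphere_act g (Some z) | g in schottky_group]
       (P1_sphere x)].

(** The set of representatives [C_j] and its strong part [C_{st,j}]. *)
Definition reps1 : set (PSL2 R) :=
  \bigcup_k [set g | side k (sphere_act g (Some (0 +i* 1)%C))
                     /\ forward k (P1_act g None)].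

Definition strong_reps1 : set (PSL2 R) :=
  [set g | reps1 g /\ limit_set (P1_act g None)].

(** The set [I^c_{st,j,k}]. *)
Definition limit_piece (k : side_index) : set (P1 R) := limit_set `\` forward k.

End OneFactor.

(** * Products *)

Section Product.
Context (R : realType) (r : nat) (S : 'I_r -> schottky R).

Local Notation G := {ffun 'I_r -> PSL2 R}.
Local Notation boundary := ('I_r -> P1 R).

Definition boundary_act (g : G) (x : boundary) : boundary :=
  fun j => P1_act (g j) (x j).

Definition nu (g : G) : boundary := fun j => P1_act (g j) None.

Definition flow_elt (t : 'I_r -> R) : G := [ffun j => geo (t j)].

Definition Gamma : set G := [set g | forall j, schottky_group (S j) (g j)].

(** Points of [Gamma \ G] are the cosets [Gamma g], as subsets of [G]. *)
Definition coset (g : G) : set G := [set (h * g)%g | h in Gamma].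

Definition flow (v : set G) (t : 'I_r -> R) : set G :=
  [set (g * flow_elt t)%g | g in v].

Definition reps : set G := [set g | forall j, reps1 (S j) (g j)].

Definition strong_reps : set G :=
  [set g | forall j, strong_reps1 (S j) (g j)].

(** Under the identification of [Gamma \ G] with the product of the
    [Gamma_j \ PSL_2(R)], this is the product of the images of the
    [reps1 (S j)]. *)
Definition cross_section : set (set G) := coset @` reps.

Definition return_times (v : set G) : set ('I_r -> R) :=
  [set t | (forall j, 0 < t j) /\ cross_section (flow v t)].

Definition is_minimum (A : set R) (a : R) := A a /\ lbound A a.

Definition next_intersection (v : set G) (t0 : 'I_r -> R) :=
  [/\ return_times v !=set0,
      forall j, is_minimum [set t j | t in return_times v] (t0 j)
    & return_times v t0].

(** The graph of the first return map on [cross_section]. *)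
Definition first_return (v w : set G) :=
  cross_section v /\ exists2 t0, next_intersection v t0 & w = flow v t0.

(** Only the values of [Rm] on [strong_reps] are constrained. *)
Definition lifts_first_return (Rm : G -> G) :=
  forall g, strong_reps g ->
    strong_reps (Rm g) /\ first_return (coset g) (coset (Rm g)).

(** Only the values of [Phi] on [nu @` strong_reps] are constrained. *)
Definition induced_system (Phi : boundary -> boundary) :=
  set_fun (nu @` strong_reps) (nu @` strong_reps) Phi /\
  exists2 Rm, lifts_first_return Rm
            & forall g, strong_reps g -> Phi (nu g) = nu (Rm g).

Definition multi_index : finType := {dffun forall j, side_index (S j)}.

Definition multi_piece (m : multi_index) : set boundary :=
  [set x | forall j, limit_piece (m j) (x j)].

Definition multi_gen (m : multi_index) : G := [ffun j => gen (m j)].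

Definition boundary_domain : set boundary := \bigcup_m multi_piece m.

(** The map [F], extended by the identity outside [boundary_domain]. *)
Definition boundary_map (x : boundary) : boundary :=
  if [pick m | `[< multi_piece m x >]] is Some m
  then boundary_act (multi_gen m) x else x.

End Product.

(** The system induced by a single factor is the case [r = 1], with
    [P1 R] identified with the functions ['I_1 -> P1 R]. *)
Definition induced_system1 (R : realType) (S : schottky R) (f : P1 R -> P1 R) :=
  set_fun (limit_set S) (limit_set S) f /\
  induced_system (fun _ : 'I_1 => S) (fun x j => f (x j)).

(* Main.v *)
(** Write [q_k] for the binary quadratic form that is negative on the disk [D_k]
    and positive outside it, and [e_1, e_2] for the standard basis. Up to positive
    factors, [q_k(g e_1) + q_k(g e_2)] is the value of [q_k] at [g(i)] and
    [q_k(g e_1)] its value at [g(oo)], while [a_t] multiplies the two terms by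
    [exp t] and [exp (- t)]. So [g] lies in [C_j] iff
    [q_k(g e_1) + q_k(g e_2) = 0 < q_k(g e_1)] for some [k]. Comparing signs on the
    real line shows that [q_{-k} o g_k] is a negative multiple of [q_k], and
    ping-pong on reduced words gives that [C_j] injects into the quotient and that
    no translate of a point outside all disks lies on a side.

    By the same ping-pong, a limit point lies in the interior of exactly one disk
    [D_k]. A geodesic starting in [C_{st,j}] and ending there stays outside all the
    disks until it crosses [s_k]; this is the first return, and [g_k] moves it back
    to [C_{st,j}]. Return times are independent in the factors, so the first return
    of the product is taken factor by factor. *)

Require Import Defs.
From mathcomp Require Import all_boot all_order all_algebra.
From mathcomp Require Import all_classical all_reals all_analysis.
From mathcomp Require Import ring lra generic_quotient.

Local Open Scope classical_set_scope.
Local Open Scope ring_scope.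

Set Implicit Arguments.
Unset Strict Implicit.
Unset Printing Implicit Defensive.

Import Order.TTheory GRing.Theory Num.Theory.
Import numFieldNormedType.Exports.

Local Open Scope quotient_scope.
Local Open Scope complex_scope.

(** * Matrix entries and homogeneous coordinates *)

Section Entries.
Context {R : realType}.
Implicit Types (g h : PSL2 R) (t : R).

(** The matrix is the representative chosen by [repr], so the entries of a product or of a class are
    known only up to a common sign. This is the source of the factors [s] with [s ^+ 2 = 1]. *)
Definition entry g (i j : 'I_2) : R := (repr g : SL2 R) i j.

Lemma det2E (F : comNzRingType) (M : 'M[F]_2) :
  \det M = M 0 0 * M 1 1 - M 0 1 * M 1 0.
Proof.
rewrite (expand_det_row _ ord0) !big_ord_recl big_ord0 addr0 /cofactor.
rewrite !det_mx11 !mxE /= expr0 expr1 mul1r mulN1r mulrN.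
by congr (M _ _ * M _ _ - M _ _ * M _ _); apply/val_inj.
Qed.

Lemma mulmx2E (F : nzRingType) (A B : 'M[F]_2) i j :
  (A *m B) i j = A i 0 * B 0 j + A i 1 * B 1 j.
Proof.
rewrite mxE !big_ord_recl big_ord0 addr0.
by congr (A _ _ * B _ _ + A _ _ * B _ _); apply/val_inj.
Qed.

Lemma entry_det g : entry g 0 0 * entry g 1 1 - entry g 0 1 * entry g 1 0 = 1.
Proof. by rewrite -det2E sl2_detE. Qed.

Lemma entry_pi (A : SL2 R) :
  exists2 s : R, s ^+ 2 = 1 &
    forall i j, entry (\pi_(PSL2 R) A) i j = s * A i j.
Proof.
have /eqP/psl2_eqP[E|E] := reprK (\pi_(PSL2 R) A).
  by exists 1; rewrite ?expr1n// => i j; rewrite /entry E mul1r.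
by exists (-1); rewrite ?sqrrN ?expr1n// => i j; rewrite /entry E mxE mulN1r.
Qed.

Lemma psl2_mulgE g h :
  (g * h)%g = \pi_(PSL2 R) (sl2_mul (repr g) (repr h)).
Proof. by rewrite psl2_mulE !reprK. Qed.

Lemma entryM g h : exists2 s : R, s ^+ 2 = 1 &
  forall i j, entry (g * h)%g i j =
    s * (entry g i 0 * entry h 0 j + entry g i 1 * entry h 1 j).
Proof.
rewrite psl2_mulgE.
have [s s1 E] := entry_pi (sl2_mul (repr g) (repr h)).
by exists s => // i j; rewrite E /= mulmx2E.
Qed.

Lemma entry_geo t : exists2 s : R, s ^+ 2 = 1 &
  [/\ entry (geo t) 0 0 = s * expR (t / 2), entry (geo t) 0 1 = 0,
      entry (geo t) 1 0 = 0 & entry (geo t) 1 1 = s * expR (- (t / 2))].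
Proof.
have [s s1 E] := entry_pi (MkSL2 (geo_subproof t)).
by exists s => //; split; rewrite /geo E /= !mxE /= ?mulr1n ?mulr0n ?mulr0.
Qed.

Lemma entry1 : exists2 s : R, s ^+ 2 = 1 &
  [/\ entry 1%g 0 0 = s, entry 1%g 0 1 = 0,
      entry 1%g 1 0 = 0 & entry 1%g 1 1 = s].
Proof.
have [s s1 E] := entry_pi (sl2_one R).
by exists s => //; split; rewrite E /= mxE ?mulr1 ?mulr0.
Qed.

Lemma sphere_actM g h (z : sphere R) :
  sphere_act (g * h)%g z = sphere_act g (sphere_act h z).
Proof.
have D k : \det (map_mx (real_complex R) (repr k : SL2 R)) != 0.
  by rewrite det_map_mx sl2_detE rmorph1 oner_neq0.
rewrite psl2_mulgE.
by rewrite sphere_actE /= map_mxM mobiusM// D.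
Qed.

Lemma P1_actM g h (x : P1 R) : P1_act (g * h)%g x = P1_act g (P1_act h x).
Proof.
have D k : \det (repr k : SL2 R) != 0 by rewrite sl2_detE oner_neq0.
rewrite psl2_mulgE.
by rewrite P1_actE /= mobiusM// D.
Qed.

Lemma P1_act_geo t : P1_act (geo t) None = None.
Proof. by rewrite P1_actE /= !mxE /= mulr0n eqxx. Qed.

Definition hom (x : P1 R) : R * R := if x is Some u then (u, 1) else (1, 0).

Definition lin g (p : R * R) : R * R :=
  (entry g 0 0 * p.1 + entry g 0 1 * p.2, entry g 1 0 * p.1 + entry g 1 1 * p.2).

Lemma lin_eq0 g p : (lin g p == 0) = (p == 0).
Proof.
apply/eqP/eqP => [[e1 e2]|->]; last by rewrite /lin /= !mulr0 !addr0.
have D := entry_det g; case: p e1 e2 => x y /= e1 e2.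
(* The adjugate inverts the matrix, whose determinant is 1. *)
have -> : x = 0.
  transitivity (entry g 1 1 * (entry g 0 0 * x + entry g 0 1 * y)
    - entry g 0 1 * (entry g 1 0 * x + entry g 1 1 * y)).
    by rewrite -[LHS]mul1r -D; ring.
  by rewrite e1 e2 !mulr0 subrr.
have -> : y = 0 => //.
transitivity (entry g 0 0 * (entry g 1 0 * x + entry g 1 1 * y)
  - entry g 1 0 * (entry g 0 0 * x + entry g 0 1 * y)).
  by rewrite -[LHS]mul1r -D; ring.
by rewrite e1 e2 !mulr0 subrr.
Qed.

Lemma hom_neq0 x : hom x != 0.
Proof.
case: x => [x|]; apply/eqP; first move=> /(congr1 snd)/eqP.
  by rewrite /= oner_eq0.
by move=> /(congr1 fst)/eqP; rewrite /= oner_eq0.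
Qed.

(** The factor is the denominator of the transformation, or its numerator when the image is
    infinity. *)
Lemma hom_act g x : exists2 s : R, s != 0 &
  lin g (hom x) = (s * (hom (P1_act g x)).1, s * (hom (P1_act g x)).2).
Proof.
have := lin_eq0 g (hom x); rewrite (negPf (hom_neq0 x)).
case: x => [x|]; rewrite /lin/=.
  rewrite !mulr1 /P1_act /= -/(entry g 1 0) -/(entry g 1 1) -/(entry g 0 0) -/(entry g 0 1).
  case: (eqVneq (entry g 1 0 * x + entry g 1 1) 0) => [->|n0 _] /=.
    move=> e; exists (entry g 0 0 * x + entry g 0 1); last by rewrite /= mulr1 mulr0.
    by apply: contraFneq e => ->.
  by exists (entry g 1 0 * x + entry g 1 1) => //=; rewrite mulr1 mulrCA divff ?mulr1.
rewrite !mulr1 !mulr0 !addr0 /P1_act /= -/(entry g 1 0) -/(entry g 0 0).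
case: (eqVneq (entry g 1 0) 0) => [->|n0 _] /=.
  move=> e; exists (entry g 0 0); last by rewrite /= mulr1 mulr0.
  by apply: contraFneq e => ->.
by exists (entry g 1 0) => //=; rewrite mulr1 mulrCA divff ?mulr1.
Qed.

End Entries.

(** * Disks as quadratic forms *)

Section Forms.
Context {R : realType}.
Implicit Types (g h : PSL2 R) (t c r : R) (p : R * R).

(** The two columns are homogeneous coordinates of [g(oo)] and [g(0)], the endpoints of the geodesic
    that the flow traces from [g(i)]. *)
Definition col1 g := (entry g 0 0, entry g 1 0).
Definition col2 g := (entry g 0 1, entry g 1 1).

Definition disk_form c r p := (p.1 - c * p.2) ^+ 2 - r ^+ 2 * p.2 ^+ 2.

(** Up to a positive factor, the value of [disk_form] at [g(i)]. *)
Definition height (f : R * R -> R) g := f (col1 g) + f (col2 g).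

Lemma sqr_denom_gt0 g : 0 < entry g 1 0 ^+ 2 + entry g 1 1 ^+ 2.
Proof.
rewrite lt0r addr_ge0 ?sqr_ge0// andbT paddr_eq0 ?sqr_ge0// !sqrf_eq0.
apply/negP => /andP[/eqP c0 /eqP d0]; have /eqP := entry_det g.
by rewrite c0 d0 !mulr0 subrr eq_sym oner_eq0.
Qed.

(** This is [(a i + b) / (c i + d)] with real denominator; the numerator has imaginary part
    [a d - b c = 1]. *)
Definition point_i g : R[i] :=
  Complex ((entry g 0 0 * entry g 1 0 + entry g 0 1 * entry g 1 1)
            / (entry g 1 0 ^+ 2 + entry g 1 1 ^+ 2))
    (entry g 1 0 ^+ 2 + entry g 1 1 ^+ 2)^-1.

Lemma act_i g :
  sphere_act g (Some (0 +i* 1)) =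
  Some (point_i g).
Proof.
have n0 := lt0r_neq0 (sqr_denom_gt0 g).
rewrite /sphere_act /= !mxE -/(entry g 0 0) -/(entry g 0 1) -/(entry g 1 0) -/(entry g 1 1).
have -> : (entry g 1 0)%:C * (0 +i* 1) + (entry g 1 1)%:C
    = Complex (entry g 1 1) (entry g 1 0).
  by apply/eqP; rewrite eq_complex /=; apply/andP; split; apply/eqP; ring.
have -> : (entry g 0 0)%:C * (0 +i* 1) + (entry g 0 1)%:C
    = Complex (entry g 0 1) (entry g 0 0).
  by apply/eqP; rewrite eq_complex /=; apply/andP; split; apply/eqP; ring.
case: eqVneq => [[d0 c0]|e0].
  by move: n0; rewrite c0 d0 !expr0n addr0 eqxx.
congr Some; apply: (canLR (mulfK e0)).
have D := entry_det g.
apply/eqP; rewrite eq_complex /=; apply/andP; split; apply/eqP.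
  (* A multiple of the determinant minus 1 is added, which leaves an identity valid for arbitrary
     entries. *)
  transitivity ((entry g 0 1 * (entry g 1 1 ^+ 2 + entry g 1 0 ^+ 2) + entry g 1 0 *
    ((entry g 0 0 * entry g 1 1 - entry g 0 1 * entry g 1 0) - 1))
     / (entry g 1 0 ^+ 2 + entry g 1 1 ^+ 2)); last by field.
  by rewrite D subrr mulr0 addr0 [_ ^+ 2 + _]addrC mulfK.
transitivity ((entry g 0 0 * (entry g 1 1 ^+ 2 + entry g 1 0 ^+ 2) - entry g 1 1 *
    ((entry g 0 0 * entry g 1 1 - entry g 0 1 * entry g 1 0) - 1))
     / (entry g 1 0 ^+ 2 + entry g 1 1 ^+ 2)); last by field.
by rewrite D subrr mulr0 subr0 [_ ^+ 2 + _]addrC mulfK.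
Qed.

(** Multiplying [g(i) - c] by the denominator of [g(i)] gives a complex number whose parts are the
    values of [x - c y] on the two columns. The sum of their squares is the height plus [r ^+ 2]
    times the squared modulus of the denominator. *)
Lemma norm_act_i g c r :
  (complex.Re (point_i g) - c) ^+ 2 + complex.Im (point_i g) ^+ 2 =
  r ^+ 2 + height (disk_form c r) g / (entry g 1 0 ^+ 2 + entry g 1 1 ^+ 2).
Proof.
have n0 := lt0r_neq0 (sqr_denom_gt0 g); have D := entry_det g.
rewrite /height /disk_form /=.
transitivity (((entry g 0 0 * entry g 1 0 + entry g 0 1 * entry g 1 1 -
    c * (entry g 1 0 ^+ 2 + entry g 1 1 ^+ 2)) ^+ 2
   + (entry g 0 0 * entry g 1 1 - entry g 0 1 * entry g 1 0) ^+ 2)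
   / (entry g 1 0 ^+ 2 + entry g 1 1 ^+ 2) ^+ 2).
  by rewrite D; field.
by field.
Qed.

Lemma norm_sub_real (w : R[i]) c :
  `|w - c%:C| = (Num.sqrt ((complex.Re w - c) ^+ 2 + complex.Im w ^+ 2))%:C.
Proof. by rewrite normc_def; case: w => x y /=; rewrite oppr0 addr0. Qed.

Lemma norm_sub_real_le (w : R[i]) c r : 0 <= r ->
  (`|w - c%:C| <= r%:C) = ((complex.Re w - c) ^+ 2 + complex.Im w ^+ 2 <= r ^+ 2).
Proof.
move=> r0; rewrite norm_sub_real lecR.
by rewrite -{1}(ger0_norm r0) -sqrtr_sqr ler_sqrt// sqr_ge0.
Qed.

Lemma norm_sub_real_lt (w : R[i]) c r : 0 < r ->
  (`|w - c%:C| < r%:C) = ((complex.Re w - c) ^+ 2 + complex.Im w ^+ 2 < r ^+ 2).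
Proof.
move=> r0; rewrite norm_sub_real ltcR.
by rewrite -{1}(gtr0_norm r0) -sqrtr_sqr ltr_sqrt// exprn_gt0.
Qed.

Lemma closed_disk_act_i g c r : 0 < r ->
  closed_disk c r (sphere_act g (Some (0 +i* 1))) <->
  height (disk_form c r) g <= 0.
Proof.
move=> r0; have n0 := sqr_denom_gt0 g.
have E : height (disk_form c r) g <= 0 <->
  `|point_i g - c%:C| <= r%:C.
  rewrite (norm_sub_real_le _ _ (ltW r0)) (norm_act_i g c r) gerDl.
  by rewrite pmulr_lle0// invr_gt0.
rewrite act_i; split => [[w H [e]]|/E H]; last by exists (point_i g).
by apply/E; rewrite -e.
Qed.

Lemma side_act_i g c r : 0 < r ->
  (Some @` [set z : R[i] | 0 < complex.Im z /\ `|z - c%:C| = r%:C])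
    (sphere_act g (Some (0 +i* 1))) <->
  height (disk_form c r) g = 0.
Proof.
move=> r0; have n0 := sqr_denom_gt0 g.
have E : height (disk_form c r) g = 0 <->
  `|point_i g - c%:C| = r%:C.
  rewrite norm_sub_real (norm_act_i g c r); split=> [->|/complexI H].
    by rewrite mul0r addr0 sqrtr_sqr gtr0_norm.
  move: (congr1 (fun x => x ^+ 2) H); rewrite sqr_sqrtr; last first.
    by rewrite -(norm_act_i g c r) addr_ge0 ?sqr_ge0.
  move/eqP; rewrite addrC -subr_eq0 addrK mulf_eq0 invr_eq0 (gt_eqF n0) orbF.
  by move/eqP.
rewrite act_i; split => [[w [_ H] [e]]|/E H].
  by apply/E; rewrite -e.
by exists (point_i g) => //; split; last exact: H; rewrite /= invr_gt0.
Qed.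

Lemma closed_disk_hom c r (x : P1 R) : 0 < r ->
  closed_disk c r (P1_sphere x) <-> disk_form c r (hom x) <= 0.
Proof.
move=> r0; rewrite /disk_form; case: x => [x|] /=; last first.
  rewrite expr0n !mulr0 !subr0 expr1n; split=> [[//]|].
  by rewrite leNgt ltr01.
have E : (x - c * 1) ^+ 2 - r ^+ 2 * 1 ^+ 2 <= 0 <-> `|x%:C - c%:C| <= r%:C.
  by rewrite (norm_sub_real_le _ _ (ltW r0)) /= expr0n addr0 expr1n !mulr1 subr_le0.
by split=> [[w H [e]]|/E H]; [apply/E; rewrite -e|exists x%:C].
Qed.

Lemma open_disk_hom c r (x : P1 R) : 0 < r ->
  open_disk c r (P1_sphere x) <-> disk_form c r (hom x) < 0.
Proof.
move=> r0; rewrite /disk_form; case: x => [x|] /=; last first.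
  rewrite expr0n !mulr0 !subr0 expr1n; split=> [[//]|].
  by rewrite ltNge ler01.
have E : (x - c * 1) ^+ 2 - r ^+ 2 * 1 ^+ 2 < 0 <-> `|x%:C - c%:C| < r%:C.
  by rewrite norm_sub_real_lt//= expr0n addr0 expr1n !mulr1 subr_lt0.
by split=> [[w H [e]]|/E H]; [apply/E; rewrite -e|exists x%:C].
Qed.

(** Homogeneity of degree two makes a form insensitive to the sign of the representative, and its
    sign insensitive to the choice of homogeneous coordinates. *)
Definition scaling_form (f : R * R -> R) :=
  forall s p, f (s * p.1, s * p.2) = s ^+ 2 * f p.

Lemma disk_form_scale c r : scaling_form (disk_form c r).
Proof. by move=> s p; rewrite /disk_form /=; ring. Qed.

Lemma col1M g h : exists2 s : R, s ^+ 2 = 1 &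
  col1 (g * h)%g = (s * (lin g (col1 h)).1, s * (lin g (col1 h)).2) /\
  col2 (g * h)%g = (s * (lin g (col2 h)).1, s * (lin g (col2 h)).2).
Proof. by have [s s1 E] := entryM g h; exists s => //; rewrite /col1 /col2 !E. Qed.

Lemma formM f g h : scaling_form f ->
  f (col1 (g * h)%g) = f (lin g (col1 h)) /\
  f (col2 (g * h)%g) = f (lin g (col2 h)).
Proof.
by move=> fZ; have [s s1 [-> ->]] := col1M g h; rewrite !fZ s1 !mul1r.
Qed.

Lemma form_geo f g t : scaling_form f ->
  f (col1 (g * geo t)%g) = expR t * f (col1 g) /\
  f (col2 (g * geo t)%g) = expR (- t) * f (col2 g).
Proof.
move=> fZ; have [s' s1' E] := entryM g (geo t).
have [s s1 [E00 E01 E10 E11]] := entry_geo t.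
have H x : expR (x / 2) ^+ 2 = expR x by rewrite -expRM_natl mulrCA divff ?mulr1.
split.
  transitivity (f (s' * s * expR (t / 2) * entry g 0 0, s' * s * expR (t / 2) * entry g 1 0)).
    by congr f; rewrite /col1 !E E00 E10; congr pair; ring.
  by rewrite (fZ _ (col1 g)) !exprMn s1 s1' H !mul1r.
transitivity (f (s' * s * expR (- (t / 2)) * entry g 0 1, s' * s * expR (- (t / 2)) * entry g 1 1)).
  by congr f; rewrite /col2 !E E01 E11; congr pair; ring.
by rewrite (fZ _ (col2 g)) !exprMn s1 s1' -mulNr H !mul1r.
Qed.

Lemma form_hom_act f g x : scaling_form f ->
  exists2 s, 0 < s & f (lin g (hom x)) = s * f (hom (P1_act g x)).
Proof.
move=> fZ; have [s s0 ->] := hom_act g x; rewrite fZ.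
by exists (s ^+ 2) => //; rewrite exprn_even_gt0.
Qed.

Lemma lin_None g : lin g (hom None) = col1 g.
Proof. by rewrite /lin /= !mulr1 !mulr0 !addr0. Qed.

(** In the centred coordinate [y = u - c], the polynomial is negative exactly where [y ^+ 2] exceeds
    [r ^+ 2]. By continuity it vanishes at both endpoints, so its linear term is zero and it equals
    [A * (y ^+ 2 - r ^+ 2)] with [A] negative. *)
Lemma opposite_disk_form (A B C c r : R) : 0 < r ->
  (forall u, A * u ^+ 2 + B * u + C < 0 <-> 0 < disk_form c r (u, 1)) ->
  exists2 l, 0 < l &
    forall p, A * p.1 ^+ 2 + B * p.1 * p.2 + C * p.2 ^+ 2 =
              - l * disk_form c r p.
Proof.
move=> r0 H.
pose P y := A * (c + y) ^+ 2 + B * (c + y) + C.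
have HP y : P y < 0 <-> r ^+ 2 < y ^+ 2.
  rewrite /P H /disk_form /= expr1n !mulr1 subr_gt0.
  by have -> : c + y - c = y by ring.
have PE y : P y = A * y ^+ 2 + (2 * A * c + B) * y + P 0 by rewrite /P; ring.
set b := 2 * A * c + B in PE; set d := P 0 in PE.
(* The signs [s = 1] and [s = -1] treat both endpoints at once. The value there is not negative; if
   it were positive, it would stay nonnegative slightly outside the interval. *)
have bnd s : s ^+ 2 = 1 -> A * r ^+ 2 + b * (s * r) + d = 0.
  move=> s1.
  have Es : P (s * r) = A * r ^+ 2 + b * (s * r) + d.
    by rewrite PE exprMn s1 mul1r.
  apply/eqP; rewrite eq_le; apply/andP; split; last first.
    rewrite -Es leNgt; apply/negP => /HP.
    by rewrite exprMn s1 mul1r ltxx.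
  rewrite leNgt; apply/negP => v0.
  set v := A * r ^+ 2 + b * (s * r) + d in v0 Es.
  (* For [e = v / K], the summand [v] of [K] ensures [e <= 1], and the other two bound the change of
     [P] between [s * r] and [s * r * (1 + e)] by [e * (K - v)], which is at most [v]. *)
  pose K := `|A| * (3 * r ^+ 2) + `|b * (s * r)| + v.
  have K0 : 0 < K by rewrite ltr_wpDl// addr_ge0// mulr_ge0// mulr_ge0// sqr_ge0.
  pose e := v / K.
  have e0 : 0 < e by rewrite divr_gt0.
  have e1 : e <= 1.
    by rewrite ler_pdivrMr// mul1r lerDr addr_ge0// mulr_ge0// mulr_ge0// sqr_ge0.
  have : P (s * r * (1 + e)) < 0.
    apply/HP; rewrite !exprMn s1 mul1r ltr_pMr ?exprn_gt0//.
    by rewrite exprn_egt1// ltrDl.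
  rewrite ltNge => /negP; apply.
  have -> : P (s * r * (1 + e)) =
     v + e * (A * (r ^+ 2 * (2 + e)) + b * (s * r)).
    by rewrite PE !exprMn s1 /v; ring.
  have -> : v = e * K by rewrite mulfVK ?gt_eqF.
  rewrite -mulrDr mulr_ge0 ?ltW//.
  have h1 : - (`|A| * (3 * r ^+ 2)) <= A * (r ^+ 2 * (2 + e)).
    rewrite lerNl; apply: le_trans (_ : `|A * (r ^+ 2 * (2 + e))| <= _).
      by rewrite -normrN ler_norm.
    rewrite normrM ler_wpM2l// ger0_norm; last first.
      by rewrite mulr_ge0 ?sqr_ge0// addr_ge0// ltW.
    by rewrite mulrC ler_wpM2r ?sqr_ge0//; lra.
  have h2 : - `|b * (s * r)| <= b * (s * r) by rewrite lerNl -normrN ler_norm.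
  rewrite /K; lra.
have b0 : b = 0.
  have e1 := bnd 1 (expr1n _ _).
  have e2 := bnd (-1) (etrans (sqrrN _) (expr1n _ _)).
  have : b * r = 0 by move: e1 e2; rewrite mulN1r mulrN mul1r; lra.
  by move/eqP; rewrite mulf_eq0 (gt_eqF r0) orbF => /eqP.
have dE : d = - A * r ^+ 2.
  by have := bnd 1 (expr1n _ _); rewrite b0 mul0r addr0; lra.
(* The sign of [A] is read off at [y = 2 * r], outside the interval. *)
exists (- A).
  have : P (2 * r) < 0 by apply/HP; rewrite exprMn; have := exprn_gt0 2 r0; nra.
  rewrite PE b0 dE mul0r addr0 exprMn; have := exprn_gt0 2 r0; nra.
move=> [x y] /=; rewrite opprK /disk_form /=.
have -> : B = - (2 * A * c) by move: b0; rewrite /b; lra.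
have -> : C = A * (c ^+ 2 - r ^+ 2).
  move: dE; rewrite /d /P addr0 => /eqP; rewrite -subr_eq0 => /eqP dE.
  have : B = - (2 * A * c) by move: b0; rewrite /b; lra.
  by move=> EB; move: dE; rewrite EB => dE; apply/eqP; rewrite -subr_eq0 -dE; apply/eqP; ring.
ring.
Qed.

End Forms.

(** * Ping-pong *)

Section PingPong.
Context {R : realType} (S : schottky R).
Implicit Types (g h : PSL2 R) (k l m : side_index S) (p : R * R) (x : P1 R).
Implicit Types w : seq (side_index S).

Definition opp k : side_index S := (k.1, ~~ k.2).
Definition qform k : R * R -> R := disk_form (@Defs.center R S k) (@Defs.radius R S k).

Lemma oppK : involutive opp.
Proof. by move=> [i b]; rewrite /opp /= negbK. Qed.

Lemma gen_opp k : gen (opp k) = (gen k)^-1%g.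
Proof. by case: k => i [] //=; rewrite /gen /= invgK. Qed.

Lemma qform_scale k : scaling_form (qform k).
Proof. exact: disk_form_scale. Qed.

Lemma disks_disjointP k l (z : sphere R) : disk k z -> disk l z -> k = l.
Proof. by move=> kz lz; apply: (@disks_disjoint R S) => //; exists z. Qed.

Lemma height_disjoint k l g :
  k != l -> height (qform k) g <= 0 -> 0 < height (qform l) g.
Proof.
move=> kl /(closed_disk_act_i _ _ (@radius_gt0 R S k)) kg; rewrite ltNge.
apply: contra kl => /(closed_disk_act_i _ _ (@radius_gt0 R S l)) lg; apply/eqP.
exact: disks_disjointP kg lg.
Qed.

Lemma hom_disjoint k l x :
  k != l -> qform k (hom x) <= 0 -> 0 < qform l (hom x).
Proof.
move=> kl /(closed_disk_hom _ _ (@radius_gt0 R S k)) kg; rewrite ltNge.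
apply: contra kl => /(closed_disk_hom _ _ (@radius_gt0 R S l)) lg; apply/eqP.
exact: disks_disjointP kg lg.
Qed.

Lemma forwardE k x : forward k x <-> 0 < qform k (hom x).
Proof.
rewrite /forward /= /disk closed_disk_hom ?radius_gt0// ltNge -/(qform k _).
by split=> /negP.
Qed.

Lemma col1E g : exists2 s, 0 < s &
  forall k, qform k (col1 g) = s * qform k (hom (P1_act g None)).
Proof.
have [s s0 E] := hom_act g None; rewrite lin_None in E.
exists (s ^+ 2) => [|k]; first by rewrite exprn_even_gt0.
by rewrite E qform_scale.
Qed.

Lemma col1_gt0 g k :
  (0 < qform k (col1 g)) = (0 < qform k (hom (P1_act g None))).
Proof. by have [s s0 ->] := col1E g; rewrite pmulr_rgt0. Qed.

Lemma col1_lt0 g k :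
  (qform k (col1 g) < 0) = (qform k (hom (P1_act g None)) < 0).
Proof. by have [s s0 ->] := col1E g; rewrite pmulr_rlt0. Qed.

Lemma col1_disjoint k l g :
  k != l -> qform k (col1 g) <= 0 -> 0 < qform l (col1 g).
Proof.
have [s s0 E] := col1E g; rewrite !E pmulr_rle0// pmulr_rgt0//.
exact: hom_disjoint.
Qed.

Lemma reps1E g :
  reps1 S g <-> exists k, height (qform k) g = 0 /\ 0 < qform k (col1 g).
Proof.
split=> [[k _ [/(side_act_i _ _ (@radius_gt0 R S k)) kg /forwardE]]|[k [kg]]].
  by rewrite -col1_gt0; exists k.
rewrite col1_gt0 => /forwardE fk; exists k => //; split => //.
exact/(side_act_i _ _ (@radius_gt0 R S k)).
Qed.

Lemma sphere_act1 (z : sphere R) : sphere_act 1%g z = z.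
Proof.
rewrite sphere_actE /=; case: z => [z|]; rewrite /= !mxE /= ?rmorph0 ?rmorph1.
  by rewrite mul0r add0r oner_eq0 mul1r addr0 divr1.
by rewrite eqxx.
Qed.

Lemma sphere_act_inj g : injective (sphere_act g).
Proof.
apply: (can_inj (g := sphere_act g^-1%g)) => z.
by rewrite -sphere_actM mulVg sphere_act1.
Qed.

(** This is the trace of [pairingP] on the real line. As [pairingP] describes an image, recovering
    the position of [x] from that of its image takes injectivity of the action. *)
Lemma pairing_sign (i : 'I_(schottky_rank S)) x :
  qform (i, false) (hom (P1_act (pairing i) x)) < 0 <->
  0 < qform (i, true) (hom x).
Proof.
have r0 := @radius_gt0 R S.
rewrite -forwardE -(open_disk_hom _ _ (r0 (i, false))) P1_sphere_act.
rewrite -pairingP; split=> [[z nz /sphere_act_inj zx]|fx]; last by exists (P1_sphere x).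
by rewrite /forward /= -zx.
Qed.

Lemma lin_lin g h p : exists2 s : R, s ^+ 2 = 1 &
  lin (g * h)%g p = (s * (lin g (lin h p)).1, s * (lin g (lin h p)).2).
Proof.
have [s s1 E] := entryM g h; exists s => //.
by rewrite /lin !E /=; congr pair; ring.
Qed.

Lemma lin1 p : exists2 s : R, s ^+ 2 = 1 & lin 1%g p = (s * p.1, s * p.2).
Proof.
have [s s1 [E00 E01 E10 E11]] := entry1 (R := R); exists s => //.
by rewrite /lin E00 E01 E10 E11 !mul0r addr0 add0r.
Qed.

(** The pullback of the form of the target disk is a quadratic form, negative on the real line
    exactly outside the source disk, so [opposite_disk_form] identifies it. *)
Lemma gen_form k : exists2 a, 0 < a &
  forall p, qform (opp k) (lin (gen k) p) = - a * qform k p.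
Proof.
case: k => i b; have r0 := @radius_gt0 R S (i, true).
set g := pairing i.
have [a a0 Ea] : exists2 a, 0 < a &
    forall p, qform (i, false) (lin g p) = - a * qform (i, true) p.
  pose c := @Defs.center R S (i, false).
  pose r := @Defs.radius R S (i, false).
  pose A := (entry g 0 0 - c * entry g 1 0) ^+ 2 - r ^+ 2 * entry g 1 0 ^+ 2.
  pose B := 2 * (entry g 0 0 - c * entry g 1 0) * (entry g 0 1 - c * entry g 1 1)
    - 2 * r ^+ 2 * entry g 1 0 * entry g 1 1.
  pose C := (entry g 0 1 - c * entry g 1 1) ^+ 2 - r ^+ 2 * entry g 1 1 ^+ 2.
  have E p : A * p.1 ^+ 2 + B * p.1 * p.2 + C * p.2 ^+ 2 =
      qform (i, false) (lin g p).
    rewrite /qform /disk_form -/c -/r /lin /A /B /C /=; ring.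
  have [u|a a0 Ea] := @opposite_disk_form _ A B C (@Defs.center R S (i, true)) _ r0.
    have -> : A * u ^+ 2 + B * u + C = qform (i, false) (lin g (hom (Some u))).
      by rewrite -E /= expr1n !mulr1.
    rewrite -/(qform (i, true) (hom (Some u))) -pairing_sign.
    have [s s0 ->] := form_hom_act g (Some u) (qform_scale (i, false)).
    by rewrite pmulr_rlt0.
  by exists a => // p; rewrite -E Ea.
case: b => /=; first by exists a.
(* For the inverse generator, the identity already shown is evaluated at [lin g^-1 p], which inverts
   the constant. *)
exists a^-1; first by rewrite invr_gt0.
move=> p; rewrite /opp /gen /= -/g.
have [s s1 E] := lin_lin g g^-1%g p; have [s' s1' E'] := lin1 p.
have : qform (i, false) (lin (g * g^-1)%g p) = qform (i, false) p.
  by rewrite mulgV E' qform_scale s1' mul1r.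
rewrite E qform_scale s1 mul1r Ea => <-.
by rewrite !mulNr mulrN opprK mulrA mulVf ?mul1r// gt_eqF.
Qed.

Lemma gen_height k g : exists2 a, 0 < a &
  height (qform (opp k)) (gen k * g)%g = - a * height (qform k) g /\
  qform (opp k) (col1 (gen k * g)%g) = - a * qform k (col1 g).
Proof.
have [a a0 E] := gen_form k; exists a => //.
have [F1 F2] := formM (gen k) g (qform_scale (opp k)).
by rewrite /height F1 F2 !E -mulrDr.
Qed.

(** * Reduced words and the ping-pong argument *)

Definition word w : PSL2 R := foldr (fun k g => (gen k * g)%g) 1%g w.
Definition reduced w := sorted (fun k l => l != opp k) w.

Lemma reduced_tail k w : reduced (k :: w) -> reduced w.
Proof. exact: path_sorted. Qed.

Lemma schottky_group_subgroup : is_subgroup (schottky_group S).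
Proof.
split=> [H [[H1 _] _]//|x y Gx Gy H HG].
by have [[_ HD] _] := HG; apply: HD; [exact: Gx|exact: Gy].
Qed.

Lemma schottky_group1 : schottky_group S 1%g.
Proof. by have [] := schottky_group_subgroup. Qed.

Lemma schottky_groupV g : schottky_group S g -> schottky_group S g^-1%g.
Proof.
have [G1 GD] := schottky_group_subgroup.
by move=> Gg; rewrite -[g^-1%g]mul1g; apply: GD.
Qed.

Lemma schottky_groupM g h :
  schottky_group S g -> schottky_group S h -> schottky_group S (g * h)%g.
Proof.
have [_ GD] := schottky_group_subgroup.
by move=> Gg /schottky_groupV Gh; rewrite -[h]invgK; apply: GD.
Qed.

Lemma schottky_group_gen k : schottky_group S (gen k).
Proof.
have G (i : 'I_(schottky_rank S)) : schottky_group S (pairing i).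
  by move=> H [_]; apply; exists i.
by case: k => i []; rewrite /gen //=; apply: schottky_groupV.
Qed.

(** By minimality of the generated subgroup, it suffices that the values of reduced words form a
    subgroup containing the generators. Prepending a letter either keeps the word reduced or cancels
    its head. *)
Lemma schottky_group_word g :
  schottky_group S g -> exists2 w, reduced w & g = word w.
Proof.
pose H : set (PSL2 R) := [set g | exists2 w, reduced w & g = word w].
have genH k h : H h -> H (gen k * h)%g.
  move=> [[|l w] rw ->]; first by exists [:: k]; rewrite /word/=.
  have [lk|lk] := eqVneq l (opp k); last first.
    by exists (k :: l :: w) => //; rewrite /reduced /= lk.
  exists w; first exact: reduced_tail rw.
  by rewrite /= lk gen_opp mulVKg.
have wordH w h : H h -> H ((word w)^-1 * h)%g.
  elim: w h => [|k w IH] h Hh /=; first by rewrite invg1 mul1g.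
  by rewrite invgM -gen_opp -mulgA; apply/IH/genH.
have wordH' w h : H h -> H (word w * h)%g.
  elim: w h => [|k w IH] h Hh /=; first by rewrite mul1g.
  by rewrite -mulgA; apply/genH/IH.
have H1 : H 1%g by exists [::].
move=> Gg; apply: (Gg H); split=> [|_ [i _ <-]]; last first.
  by have := genH (i, true) _ H1; rewrite mulg1.
split=> // x y [w _ ->] [w' _ ->]; apply: wordH'.
by rewrite -[_^-1%g]mulg1; apply: wordH.
Qed.

Lemma gen_height_lt0 k g : 0 < height (qform k) g ->
  height (qform (opp k)) (gen k * g)%g < 0.
Proof.
by move=> kg; have [a a0 [-> _]] := gen_height k g; rewrite mulNr oppr_lt0 mulr_gt0.
Qed.

(** The tail moves [g(i)] into the disk opposite to its first letter [l]. Reducedness makes that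
    disk different from the disk [k], so the point is outside the latter and [gen k] sends it into
    the disk [opp k]. *)
Lemma word_height k w g : (forall m, 0 < height (qform m) g) ->
  reduced (k :: w) -> height (qform (opp k)) (word (k :: w) * g)%g < 0.
Proof.
move=> Fg; elim: w k => [|l w IH] k.
  by move=> _; rewrite /= mulg1; apply: gen_height_lt0.
move=> rw; have /andP[lk _] := rw; rewrite /= -mulgA; apply: gen_height_lt0.
have /ltW := IH _ (reduced_tail rw); apply: height_disjoint.
by apply: contra lk => /eqP <-; rewrite oppK.
Qed.

Lemma schottky_group_height g h : (forall m, 0 < height (qform m) g) ->
  schottky_group S h -> h = 1%g \/ exists m, height (qform m) (h * g)%g < 0.
Proof.
move=> Fg /schottky_group_word[[|k w] rw ->]; [by left|right].
by exists (opp k); apply: word_height.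
Qed.

Lemma height_lt0_reps1 m g : height (qform m) g < 0 -> ~ reps1 S g.
Proof.
move=> mg /reps1E[k [k0 _]]; have [mk|mk] := eqVneq m k.
  by move: mg; rewrite mk k0 ltxx.
by have := height_disjoint mk (ltW mg); rewrite k0 ltxx.
Qed.

Lemma outside_not_reps1 g h : (forall m, 0 < height (qform m) g) ->
  schottky_group S h -> ~ reps1 S (h * g)%g.
Proof.
move=> Fg /(schottky_group_height Fg)[->|[m /height_lt0_reps1//]].
by rewrite mul1g => /reps1E[k [k0 _]]; have := Fg k; rewrite k0 ltxx.
Qed.

(** Ping-pong now starts on a side [a]. The first letter applied either moves [g(i)] into an open
    disk or, if it is [a], onto the opposite side with the forward endpoint inside that disk; any
    further letter leads into an open disk. Neither outcome is possible for an element of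
    [reps1]. *)
Lemma reps1_inj g h :
  schottky_group S h -> reps1 S g -> reps1 S (h * g)%g -> h = 1%g.
Proof.
move=> /schottky_group_word[[|k w] rw ->] // /reps1E[a [a0 aP]].
have : height (qform (opp k)) (word (k :: w) * g)%g < 0 \/
    height (qform (opp k)) (word (k :: w) * g)%g = 0 /\
    qform (opp k) (col1 (word (k :: w) * g)%g) < 0.
  elim: w k rw => [|l w IH] k rw.
    rewrite /= mulg1; have [->|ak] := eqVneq k a.
      right; have [e e0 [-> ->]] := gen_height a g.
      by rewrite a0 mulr0 mulNr oppr_lt0 mulr_gt0.
    left; apply/gen_height_lt0/(@height_disjoint a); first by rewrite eq_sym.
    by rewrite a0.
  left; have /andP[lk _] := rw; rewrite /= -mulgA; apply: gen_height_lt0.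
  apply: (@height_disjoint (opp l)).
    by apply: contra lk => /eqP <-; rewrite oppK.
  by have [/ltW//|[-> _]] := IH _ (reduced_tail rw).
move=> [/height_lt0_reps1//|[k0 kP]] /reps1E[b [b0 bP]].
have [kb|kb] := eqVneq (opp k) b.
  by move: bP; rewrite -kb ltNge (ltW kP).
have k0' : height (qform (opp k)) (word (k :: w) * g)%g <= 0 by rewrite k0.
by have := height_disjoint kb k0'; rewrite b0 ltxx.
Qed.

End PingPong.

(** * Neighbourhoods of boundary points *)

Section Near.
Context {R : realType}.
Implicit Types (g h : PSL2 R) (p q : R * R) (x : P1 R).

Definition det_sqr p q := (p.1 * q.2 - p.2 * q.1) ^+ 2.
Definition norm_sqr q : R := q.1 ^+ 2 + q.2 ^+ 2.

(** [height (det_sqr p) g / height norm_sqr g] is comparable to the squared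
    chordal distance from [g(i)] to the boundary point with homogeneous
    coordinates [p]. *)
Definition near_dir p (e : R) g := height (det_sqr p) g < e * height norm_sqr g.

Lemma det_sqr_scale p : scaling_form (det_sqr p).
Proof. by move=> s q; rewrite /det_sqr /=; ring. Qed.

Lemma norm_sqr_scale : scaling_form norm_sqr.
Proof. by move=> s q; rewrite /norm_sqr /=; ring. Qed.

Lemma norm_sqr_gt0 p : p != 0 -> 0 < norm_sqr p.
Proof.
move=> p0; rewrite /norm_sqr lt0r addr_ge0 ?sqr_ge0// andbT.
rewrite paddr_eq0 ?sqr_ge0// !sqrf_eq0; apply: contra p0.
by case: p => x y /= /andP[/eqP-> /eqP->].
Qed.

Lemma height_norm_gt0 g : 0 < height norm_sqr g.
Proof.
have := sqr_denom_gt0 g; rewrite /height /norm_sqr /=.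
have := sqr_ge0 (entry g 0 0); have := sqr_ge0 (entry g 0 1); lra.
Qed.

(** The columns of [g] form a basis, so a nonzero [p] cannot be parallel to both. *)
Lemma height_det_gt0 p g : p != 0 -> 0 < height (det_sqr p) g.
Proof.
move=> p0; have D := entry_det g.
rewrite lt0r addr_ge0 ?sqr_ge0// andbT paddr_eq0 ?sqr_ge0//.
rewrite !sqrf_eq0; apply: contra p0 => /andP[/eqP /= e1 /eqP e2].
case: p e1 e2 => x y /= e1 e2; apply/eqP; congr pair.
  transitivity (- entry g 0 1 * (x * entry g 1 0 - y * entry g 0 0)
     + entry g 0 0 * (x * entry g 1 1 - y * entry g 0 1)); last first.
    by rewrite e1 e2 !mulr0 addr0.
  by rewrite -[LHS]mulr1 -D; ring.
transitivity (- entry g 1 1 * (x * entry g 1 0 - y * entry g 0 0)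
   + entry g 1 0 * (x * entry g 1 1 - y * entry g 0 1)); last first.
  by rewrite e1 e2 !mulr0 addr0.
by rewrite -[LHS]mulr1 -D; ring.
Qed.

Lemma near_dir_le p (d e : R) g : d <= e -> near_dir p d g -> near_dir p e g.
Proof.
by move=> de /lt_le_trans; apply; rewrite ler_wpM2r// ltW// height_norm_gt0.
Qed.

Lemma near_dir_min p (d e : R) g :
  near_dir p (Num.min d e) g -> near_dir p d g /\ near_dir p e g.
Proof. by move=> H; split; apply: near_dir_le H; rewrite ge_min lexx ?orbT. Qed.

(** The radius is the quotient of heights at [g] itself. In ping-pong this excludes the group
    elements that fix the base point's position near the boundary, such as the identity. *)
Lemma near_dir_not p g : p != 0 ->
  exists2 d, 0 < d & forall h, near_dir p d h -> h != g.
Proof.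
move=> p0; have n0 := height_norm_gt0 g.
exists (height (det_sqr p) g / height norm_sqr g).
  by rewrite divr_gt0// height_det_gt0.
move=> h; apply: contraTneq => ->.
by rewrite /near_dir divfK ?ltxx// gt_eqF.
Qed.

Lemma near_dir_scale s p e g : s != 0 ->
  near_dir (s * p.1, s * p.2) (s ^+ 2 * e) g = near_dir p e g.
Proof.
move=> s0; rewrite /near_dir.
have -> : height (det_sqr (s * p.1, s * p.2)) g = s ^+ 2 * height (det_sqr p) g.
  by rewrite /height /det_sqr /=; ring.
by rewrite -mulrA ltr_pM2l// exprn_even_gt0.
Qed.

(** The map [lin h] has determinant 1 and preserves [det_sqr], while it shrinks [norm_sqr] at most
    by the sum [C] of the squared entries of [h]. *)
Lemma near_dir_lin p h e : 0 < e ->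
  exists2 d, 0 < d & forall g, near_dir p d g -> near_dir (lin h p) e (h * g)%g.
Proof.
move=> e0.
pose C := height norm_sqr h.
have C0 : 0 < C := height_norm_gt0 h.
exists (e / C); first by rewrite divr_gt0.
move=> g gp; have D := entry_det h; rewrite /near_dir /height.
have [-> ->] := formM h g (det_sqr_scale (lin h p)).
have [-> ->] := formM h g norm_sqr_scale.
have E q : det_sqr (lin h p) (lin h q) = det_sqr p q.
  transitivity ((entry h 0 0 * entry h 1 1 - entry h 0 1 * entry h 1 0) ^+ 2 * det_sqr p q).
    by rewrite /det_sqr /lin /=; ring.
  by rewrite D expr1n mul1r.
rewrite !E; apply: lt_le_trans gp _.
have N q : norm_sqr q <= C * norm_sqr (lin h q).
  set u := (lin h q).1; set v := (lin h q).2.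
  have -> : norm_sqr q = (entry h 1 1 * u - entry h 0 1 * v) ^+ 2 +
      (- entry h 1 0 * u + entry h 0 0 * v) ^+ 2.
    transitivity ((entry h 0 0 * entry h 1 1 - entry h 0 1 * entry h 1 0) ^+ 2 * norm_sqr q).
      by rewrite D expr1n mul1r.
    by rewrite /norm_sqr /u /v /lin /=; ring.
  rewrite -subr_ge0.
  (* This is the Cauchy-Schwarz inequality with its remainder written as a sum of squares. *)
  have -> : C * norm_sqr (lin h q) - ((entry h 1 1 * u - entry h 0 1 * v) ^+ 2 +
      (- entry h 1 0 * u + entry h 0 0 * v) ^+ 2) =
      (entry h 1 1 * v + entry h 0 1 * u) ^+ 2 +
      (entry h 0 0 * u + entry h 1 0 * v) ^+ 2.
    by rewrite /C /height /norm_sqr -/u -/v /=; ring.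
  by rewrite addr_ge0 ?sqr_ge0.
rewrite -mulrA ler_pM2l// mulrC ler_pdivrMr// mulrC mulrDr.
exact: lerD.
Qed.

(** Writing a vector in the orthogonal basis [p], [p^_|_], the form is at least
    [a |v|^2 - K det(p, v)^2] for suitable [a > 0]. *)
Lemma near_dir_disk_form p c r : 0 < disk_form c r p ->
  exists2 d, 0 < d & forall g, near_dir p d g -> 0 < height (disk_form c r) g.
Proof.
set Q := disk_form c r p => Q0.
have p0 : p != 0.
  apply: contraTneq Q0 => p0; rewrite /Q p0 /disk_form /=.
  by rewrite !mulr0 subr0 expr0n mulr0 subr0 ltxx.
pose n := norm_sqr p; have n0 : 0 < n := norm_sqr_gt0 p0.
pose x := p.1; pose y := p.2.
(* [b] is the polar form at [p] and its orthogonal vector [(- y, x)], and [T] is the form at that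
   vector. *)
pose b := (x - c * y) * (- y - c * x) - r ^+ 2 * y * x.
pose T := disk_form c r (- y, x).
pose K := 2 * b ^+ 2 / Q + `|T| + Q / 2.
have K0 : 0 < K.
  apply: ltr_wpDl; last by rewrite divr_gt0.
  by rewrite addr_ge0// divr_ge0 ?(ltW Q0)// mulr_ge0// sqr_ge0.
have bnd q : Q * n / 2 * norm_sqr q - K * det_sqr p q <= n ^+ 2 * disk_form c r q.
  pose s := x * q.1 + y * q.2; pose t := x * q.2 - y * q.1.
  have -> : n ^+ 2 * disk_form c r q = s ^+ 2 * Q + 2 * s * t * b + t ^+ 2 * T.
    rewrite /n /norm_sqr /disk_form /s /t /b /T /Q /disk_form /= -/x -/y; ring.
  have -> : det_sqr p q = t ^+ 2 by [].
  have -> : Q * n / 2 * norm_sqr q = Q / 2 * (s ^+ 2 + t ^+ 2).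
    rewrite /n /norm_sqr /s /t -/x -/y; ring.
  (* Completing the square spends half of [s ^+ 2 * Q] on the cross term; the cost in [t ^+ 2] is
     the first summand of [K]. *)
  have h1 : 0 <= (s * Q + 2 * t * b) ^+ 2 / (2 * Q).
    by rewrite divr_ge0 ?sqr_ge0// mulr_ge0// ltW.
  have h2 : (s * Q + 2 * t * b) ^+ 2 / (2 * Q) =
      s ^+ 2 * Q / 2 + 2 * s * t * b + t ^+ 2 * (2 * b ^+ 2 / Q).
    by field; rewrite gt_eqF.
  have h3 : - (t ^+ 2 * `|T|) <= t ^+ 2 * T.
    by rewrite -mulrN ler_wpM2l ?sqr_ge0// lerNl -normrN ler_norm.
  rewrite h2 in h1; rewrite -subr_ge0 /K.
  apply: le_trans (addr_ge0 h1 (_ : 0 <= t ^+ 2 * T + t ^+ 2 * `|T|)) _.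
    by rewrite -lerBlDr sub0r.
  by rewrite le_eqVlt; apply/orP; left; apply/eqP; field; rewrite gt_eqF.
exists (Q * n / 2 / K); first by rewrite !divr_gt0// mulr_gt0.
move=> g; rewrite /near_dir [_ / K * _]mulrAC ltr_pdivlMr// => H.
rewrite -(pmulr_rgt0 _ (exprn_gt0 2 n0)).
apply: lt_le_trans (_ : Q * n / 2 * height norm_sqr g - K * height (det_sqr p) g <= _).
  by rewrite subr_gt0 mulrC.
by have := bnd (col1 g); have := bnd (col2 g); rewrite /height; lra.
Qed.

Lemma near_dir_all (I : finType) (P : I -> PSL2 R -> Prop) p :
  (forall i, exists2 d, 0 < d & forall g, near_dir p d g -> P i g) ->
  exists2 d, 0 < d & forall g, near_dir p d g -> forall i, P i g.
Proof.
move=> H; have [d Hd] : {d : I -> R & forall i,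
    0 < d i /\ forall g, near_dir p (d i) g -> P i g}.
  apply: (@choice _ _ (fun i d => 0 < d /\ forall g, near_dir p d g -> P i g)) => i.
  by have [d d0 dP] := H i; exists d.
(* The default value 1 covers an empty index type. *)
exists (\big[Num.min/1]_i d i).
  by apply: lt_bigmin => // i _; have [] := Hd i.
move=> g gd i; have [_] := Hd i; apply.
by apply: near_dir_le gd; apply: bigmin_le_cond.
Qed.

End Near.

(** * Limit set *)

Section LimitSet.
Context {R : realType} (S : schottky R).
Implicit Types (g h : PSL2 R) (k l : side_index S) (p : R * R) (x : P1 R).

Lemma psl2_entries (a b c d : R) : a * d - b * c = 1 ->
  exists g (s : R), [/\ s ^+ 2 = 1, entry g 0 0 = s * a, entry g 0 1 = s * b,
    entry g 1 0 = s * c & entry g 1 1 = s * d].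
Proof.
move=> D; pose M : 'M[R]_2 := \matrix_(i, j)
  if i == 0 then if j == 0 then a else b else if j == 0 then c else d.
have detM : \det M == 1 by rewrite det2E !mxE /= D.
have [s s1 E] := entry_pi (MkSL2 detM).
by exists (\pi_(PSL2 R) (MkSL2 detM)), s; split=> //; rewrite E /= mxE.
Qed.

Lemma point_i_gt0 g : 0 < complex.Im (point_i g).
Proof. by rewrite /= invr_gt0 sqr_denom_gt0. Qed.

Lemma point_i_surj (z : R[i]) : 0 < complex.Im z -> exists g, point_i g = z.
Proof.
case: z => x y /= y0; have s0 : 0 < Num.sqrt y by rewrite sqrtr_gt0.
have sy : Num.sqrt y ^+ 2 = y by rewrite sqr_sqrtr// ltW.
have [|g [s [s1 _ E01 E10 E11]]] :=
  @psl2_entries (Num.sqrt y) (x / Num.sqrt y) 0 (Num.sqrt y)^-1.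
  by rewrite mulr0 subr0 divff// gt_eqF.
exists g; rewrite /point_i E01 E10 E11 !mulr0 !expr0n !add0r exprMn s1 mul1r.
rewrite exprVn sy invrK; congr Complex.
transitivity (s ^+ 2 * (x * y / Num.sqrt y ^+ 2)); last by rewrite s1 mul1r sy mulfK// gt_eqF.
by field; rewrite gt_eqF.
Qed.

Lemma sphere_act_orbit g h (z : R[i]) :
  point_i g = z -> sphere_act h (Some z) = Some (point_i (h * g)%g).
Proof. by move=> <-; rewrite -act_i -sphere_actM act_i. Qed.

(** Dividing both heights by the squared modulus of the denominator of [z = g(i)] turns them into
    the squared modulus of [z - x] and one plus that of [z]. *)
Lemma near_dir_Some (x e : R) g : near_dir (hom (Some x)) e g =
  ((complex.Re (point_i g) - x) ^+ 2 + complex.Im (point_i g) ^+ 2 <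
   e * ((complex.Re (point_i g)) ^+ 2 + complex.Im (point_i g) ^+ 2 + 1)).
Proof.
have n0 := sqr_denom_gt0 g.
have := norm_act_i g 0 0; rewrite subr0 => ->; rewrite (norm_act_i g x 0).
rewrite expr0n !add0r /near_dir.
rewrite -(ltr_pM2r n0 (_ / _)) divfK ?gt_eqF// -mulrA mulrDl divfK ?gt_eqF//.
have -> : height (det_sqr (hom (Some x))) g = height (disk_form x 0) g.
  by rewrite /height /det_sqr /disk_form /=; ring.
by congr (_ < _ * _); rewrite /height /norm_sqr /disk_form /=; ring.
Qed.

Lemma near_dir_None (e : R) g : near_dir (hom None) e g =
  (1 < e * ((complex.Re (point_i g)) ^+ 2 + complex.Im (point_i g) ^+ 2 + 1)).
Proof.
have n0 := sqr_denom_gt0 g.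
have := norm_act_i g 0 0; rewrite subr0 => ->.
rewrite expr0n !add0r /near_dir.
rewrite -(ltr_pM2r n0 1) mul1r -mulrA mulrDl divfK ?gt_eqF// mul1r.
by congr (_ < _ * _); rewrite /height /norm_sqr /det_sqr /disk_form /=; ring.
Qed.

(** Accumulation of orbits in homogeneous coordinates, which treats infinity like every other
    boundary point and is compatible with linear maps. *)
Definition orbit_clusters p := forall g e, 0 < e ->
  exists2 h, schottky_group S h & near_dir p e (h * g)%g.

Lemma real_complex_gt0 (e : R[i]) : 0 < e -> exists2 d : R, 0 < d & e = d%:C.
Proof.
case: e => a b; rewrite ltcE /= => /andP[/eqP b0 a0].
by exists a; rewrite // b0.
Qed.

Lemma nbhs_real_complex (x d : R) : 0 < d ->
  nbhs (x%:C : (R[i] : numFieldType)) [set w | `|w - x%:C| < d%:C].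
Proof.
move=> d0; apply/nbhs_ballP; exists d%:C; first by rewrite /= ltcR.
by move=> w; rewrite /ball /= distrC.
Qed.

Lemma complex_pair_continuous :
  continuous (fun u : R * R => Complex u.1 u.2 : (R[i] : numFieldType)).
Proof.
move=> [a b]; apply/cvgrPdist_lt => e /real_complex_gt0[d d0 ->].
have d2 : 0 < d / 2 by rewrite divr_gt0.
have /cvgrPdist_lt/(_ _ d2) fst_ab : fst u @[u --> (a, b)] --> a by exact: cvg_fst.
have /cvgrPdist_lt/(_ _ d2) snd_ab : snd u @[u --> (a, b)] --> b by exact: cvg_snd.
near=> u.
have -> : Complex a b - Complex u.1 u.2 = Complex (a - u.1) (b - u.2) by [].
have h1 : `|a - u.1| < d / 2 by near: u.
have h2 : `|b - u.2| < d / 2 by near: u.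
rewrite normc_def /= ltcR.
rewrite -(gtr0_norm d0) -sqrtr_sqr ltr_sqrt ?exprn_gt0//.
rewrite -(real_normK (num_real (a - u.1))) -(real_normK (num_real (b - u.2))).
have := normr_ge0 (a - u.1); have := normr_ge0 (b - u.2); nra.
Unshelve. all: by end_near. Qed.

(** Complements of these compact sets provide neighbourhoods of infinity in the sphere. *)
Definition square (B : R) : set (R[i] : numFieldType) :=
  (fun u : R * R => Complex u.1 u.2) @` (`[- B, B] `*` `[- B, B]).

Lemma square_compact B : compact (square B).
Proof.
apply: continuous_compact; last by apply: compact_setX; exact: segment_compact.
exact/continuous_subspaceT/complex_pair_continuous.
Qed.

Lemma nbhs_infty (B : R) :
  nbhs (None : sphere R) ((Some @` (~` square B)) `|` [set None]).
Proof.
exists (square B) => //; split; first exact: square_compact.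
apply: compact_closed; last exact: square_compact.
exact: norm_hausdorff.
Qed.

Lemma limit_set_orbit_clusters x : limit_set S x -> orbit_clusters (hom x).
Proof.
move=> Lx g e e0; have /Lx Lz := point_i_gt0 g.
case: x Lx Lz => [x|] Lx Lz.
  (* The radius [Num.sqrt e] is enough because the right-hand side in [near_dir_Some] is at least
     [e]. *)
  have d0 : 0 < Num.sqrt e by rewrite sqrtr_gt0.
  have [] := Lz (Some @` [set w : R[i] | `|w - x%:C| < (Num.sqrt e)%:C]).
    exact/one_point_compactification_some_nbhs/nbhs_real_complex.
  move=> _ [_ [h Gh <-] [w wx wE]]; exists h => //.
  move: wE wx; rewrite (sphere_act_orbit h (erefl (point_i g))) => -[->].
  rewrite /= norm_sub_real_lt// sqr_sqrtr ?ltW// => H.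
  rewrite near_dir_Some; apply: lt_le_trans H _.
  by rewrite -[leLHS]mulr1 ler_wpM2l ?(ltW e0)// lerDr addr_ge0// sqr_ge0.
(* Outside this square one coordinate exceeds [1 + e^-1] in absolute value, so its square exceeds
   [e^-1]. *)
have [] := Lz _ (nbhs_infty (1 + e^-1)).
move=> _ [_ [h Gh <-] []]; last by rewrite (sphere_act_orbit h (erefl (point_i g))).
move=> [w nw wE]; exists h => //.
move: wE; rewrite (sphere_act_orbit h (erefl (point_i g))) => -[wE].
rewrite near_dir_None -ltr_pdivrMl// mulr1 -wE.
set B := 1 + e^-1; have e'0 : 0 < e^-1 by rewrite invr_gt0.
have B0 : 0 < B by rewrite addr_gt0.
have BB : e^-1 < B ^+ 2 by rewrite /B; nra.
have far u : B < `|u| -> e^-1 < u ^+ 2.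
  move=> Bu; apply: lt_trans BB _; rewrite -(real_normK (num_real u)).
  by rewrite ltr_sqr// ?nnegrE// ltW.
have [h1|/far h1] := leP `|complex.Re w| B; last first.
  by rewrite ltr_wpDr// ltr_wpDr// sqr_ge0.
have [h2|/far h2] := leP `|complex.Im w| B; last first.
  by rewrite ltr_wpDr// ltr_wpDl// sqr_ge0.
case: nw; exists (complex.Re w, complex.Im w); last by case: (w).
by split; rewrite /= in_itv /= -ler_norml.
Qed.

Lemma orbit_clusters_limit_set (x : R) :
  orbit_clusters (hom (Some x)) -> limit_set S (Some x).
Proof.
move=> Ax z /point_i_surj[g gz] U.
rewrite {1}/nbhs /= => /nbhs_ballP[_ /= /real_complex_gt0[d d0 ->] dU].
pose N := 2 * x ^+ 2 + 1; have N0 : 0 < N by rewrite ltr_wpDl// mulr_ge0// sqr_ge0.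
(* Let [W] be the squared distance from the orbit point [z] to [x]. The squared modulus of [z] plus
   one is at most [2 * W + N], so with this radius [W] must be less than [d ^+ 2]. *)
have e0 : 0 < d ^+ 2 / (2 * d ^+ 2 + N).
  by rewrite divr_gt0 ?exprn_gt0// addr_gt0// mulr_gt0// exprn_gt0.
have [h Gh] := Ax g _ e0; rewrite near_dir_Some => H.
exists (Some (point_i (h * g)%g)); split.
- apply/eqP => -[_ /eqP].
  by rewrite gt_eqF// invr_gt0 sqr_denom_gt0.
- by exists h => //; apply: sphere_act_orbit.
- apply: dU; rewrite /ball /= distrC norm_sub_real_lt//.
  set u := complex.Re _ in H *; set v := complex.Im _ in H *.
  rewrite mulrAC ltr_pdivlMr in H; last first.
    by rewrite addr_gt0// mulr_gt0// exprn_gt0.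
  have D0 := exprn_gt0 2 d0; have V0 := sqr_ge0 v.
  have U0 := sqr_ge0 (u - 2 * x).
  rewrite ltNge; apply/negP => le_d; move: H; rewrite ltNge => /negP; apply.
  have h1 : d ^+ 2 * (u ^+ 2 + v ^+ 2 + 1) <=
      d ^+ 2 * (2 * ((u - x) ^+ 2 + v ^+ 2) + N).
    by rewrite ler_pM2l// /N; nra.
  apply: le_trans h1 _; set W := (u - x) ^+ 2 + v ^+ 2 in le_d *.
  have -> : d ^+ 2 * (2 * W + N) = W * (2 * d ^+ 2) + d ^+ 2 * N by ring.
  by rewrite [leRHS]mulrDr lerD2l ler_pM2r.
Qed.

(** The point [i * expR t] lies above every disk when [t] is the sum of the radii, since
    [expR t >= 1 + t]. *)
Lemma base_point : exists g, forall k, 0 < height (qform k) g.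
Proof.
pose t := \sum_k @Defs.radius R S k.
have rt k : @Defs.radius R S k <= t.
  rewrite /t (bigD1 k) //= lerDl; apply: sumr_ge0 => l _.
  by rewrite ltW ?radius_gt0.
exists (1 * geo t)%g => k; have r0 := @radius_gt0 R S k.
rewrite /height; have [-> ->] := form_geo 1%g t (qform_scale k).
have [s s1 [E00 E01 E10 E11]] := entry1 (R := R).
rewrite /qform /disk_form /= E00 E01 E10 E11 !mulr0 subr0 s1 expr0n /= mulr0 subr0 mulr1.
rewrite sub0r sqrrN exprMn s1 !mulr1.
have tE : Defs.radius k < expR t.
  by apply: (le_lt_trans (rt k)); have := expR_ge1Dx t; lra.
rewrite expRN.
have e0 := expR_gt0 t; rewrite -(pmulr_rgt0 _ e0) mulrDr mulrA divff ?gt_eqF// mul1r.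
have := sqr_ge0 (Defs.center k); nra.
Qed.

(** Orbit points close to such a [p] would lie outside all the disks. By ping-pong from a base point
    only the identity does this, and it stays at a positive distance from [p]. *)
Lemma orbit_clusters_outside p : p != 0 -> orbit_clusters p -> 
  ~ forall k, 0 < qform k p.
Proof.
move=> p0 Ap out; have [g Fg] := base_point.
have [d1 d10 H1] := near_dir_not g p0.
have [d2 d20 H2] := near_dir_all (fun k => near_dir_disk_form (out k)).
have d0 : 0 < Num.min d1 d2 by rewrite lt_min d10.
have [h Gh /near_dir_min[/H1 + /H2 Fh]] := Ap g _ d0.
have [->|[m mh] _] := schottky_group_height Fg Gh; first by rewrite mul1g eqxx.
by have := Fh m; rewrite /qform ltNge (ltW mh).
Qed.

Lemma orbit_clusters_lin p h :
  schottky_group S h -> orbit_clusters p -> orbit_clusters (lin h p).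
Proof.
move=> Gh Ap g e e0; have [d d0 H] := near_dir_lin p h e0.
have [f Gf fp] := Ap g _ d0; exists (h * f)%g; first exact: schottky_groupM.
by rewrite -mulgA; apply: H.
Qed.

Lemma orbit_clusters_act x h : schottky_group S h ->
  orbit_clusters (hom x) -> orbit_clusters (hom (P1_act h x)).
Proof.
move=> Gh /(orbit_clusters_lin Gh); have [s s0 ->] := hom_act h x => A g e e0.
have [|f Gf] := A g (s ^+ 2 * e); first by rewrite mulr_gt0// exprn_even_gt0.
by rewrite near_dir_scale//; exists f.
Qed.

(** If the limit point lies on the boundary of the disk [k], orbit points near
    it are inside that disk, so that their images under [gen k] avoid all the
    disks. *)
Lemma orbit_clusters_inside x :
  orbit_clusters (hom x) -> exists k, qform k (hom x) < 0.
Proof.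
move=> Ax; apply: contrapT => /forallNP nin.
have ge0 k : 0 <= qform k (hom x) by rewrite leNgt; apply/negP/nin.
have [[k k0]|] := pselect (exists k, qform k (hom x) = 0); last first.
  move=> /forallNP n0; apply: (orbit_clusters_outside (hom_neq0 x) Ax) => k.
  by rewrite lt_neqAle ge0 andbT eq_sym; apply/eqP/n0.
have p0 := hom_neq0 x.
have out l : k != l -> 0 < qform l (hom x).
  by move=> kl; apply: (hom_disjoint kl); rewrite k0.
(* The image of [x] under [gen k] lies on the boundary of the disk [opp k], hence outside all the
   others. *)
have out' l : opp k != l -> 0 < qform l (lin (gen k) (hom x)).
  move=> kl; have [s s0 ->] := form_hom_act (gen k) x (qform_scale l).
  rewrite mulr_gt0//; apply: (hom_disjoint kl).
  have [s' s'0 E] := form_hom_act (gen k) x (qform_scale (opp k)).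
  rewrite -(pmulr_rle0 _ s'0) -E; have [a a0 ->] := gen_form k.
  by rewrite k0 mulr0.
have [g Fg] := base_point.
have [d1 d10 H1] := near_dir_not g p0.
have [d2 d20 H2] := near_dir_not ((gen k)^-1 * g)%g p0.
have [d3 d30 H3] : exists2 d, 0 < d & forall h, near_dir (hom x) d h ->
    forall l, k != l -> 0 < height (qform l) h.
  apply: near_dir_all => l; have [<-|kl] := eqVneq k l; first by exists 1.
  by have [d d0 H] := near_dir_disk_form (out l kl); exists d => // h /H.
have [d4 d40 H4] : exists2 d, 0 < d & forall h, near_dir (hom x) d h ->
    forall l, opp k != l -> 0 < height (qform l) (gen k * h)%g.
  apply: near_dir_all => l; have [<-|kl] := eqVneq (opp k) l; first by exists 1.
  have [e e0 H] := near_dir_disk_form (out' l kl).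
  have [d d0 H'] := near_dir_lin (hom x) (gen k) e0.
  by exists d => // h /H'/H.
(* The first two radii exclude [h = 1] and [h = (gen k)^-1]; the other two keep [h * g] outside
   every disk but [k], and [gen k * h * g] outside every disk but [opp k]. *)
have d0 : 0 < Num.min (Num.min d1 d2) (Num.min d3 d4).
  by rewrite !lt_min d10 d20 d30.
have [h Gh /near_dir_min[/near_dir_min[/H1 h1 /H2 h2]]] := Ax g _ d0.
move=> /near_dir_min[/H3 h3 /H4 h4].
have [h1'|[m mh]] := schottky_group_height Fg Gh.
  by move: h1; rewrite h1' mul1g eqxx.
have km : k = m.
  by apply/eqP/negPn/negP => /h3; rewrite ltNge (ltW mh).
have kh : 0 < height (qform (opp k)) (gen k * (h * g))%g.
  have [a a0 [-> _]] := gen_height k (h * g)%g.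
  by rewrite km mulNr oppr_gt0 pmulr_rlt0.
have Fh l : 0 < height (qform l) ((gen k * h) * g)%g.
  by rewrite -mulgA; have [<-//|/h4] := eqVneq (opp k) l.
have [kh1|[l lh]] := schottky_group_height Fg (schottky_groupM (schottky_group_gen k) Gh).
  by move: h2; rewrite -[h](mulKg (gen k)) kh1 mulg1 eqxx.
by have := Fh l; rewrite ltNge (ltW lh).
Qed.

End LimitSet.

(** * First return in one factor *)

Section Return.
Context {R : realType} (S : schottky R).
Implicit Types (g h : PSL2 R) (k l : side_index S) (x : P1 R) (s t : R).

Lemma limit_set_inside x : limit_set S x -> exists k, qform k (hom x) < 0.
Proof. by move=> /limit_set_orbit_clusters/orbit_clusters_inside. Qed.

Lemma limit_set_act h x : schottky_group S h ->
  limit_set S x -> limit_set S (P1_act h x).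
Proof.
move=> Gh /limit_set_orbit_clusters/(orbit_clusters_act Gh) A.
case: (P1_act h x) A => [y|] A; first exact: orbit_clusters_limit_set.
(* Infinity lies outside every disk, so orbits cannot cluster there. *)
have [k] := orbit_clusters_inside A.
rewrite /qform /disk_form /= expr0n /= !mulr0 !subr0 expr1n.
by rewrite ltNge ler01.
Qed.

Lemma limit_piece_le0 k x : limit_piece k x -> qform k (hom x) <= 0.
Proof. by move=> [_ nf]; rewrite leNgt; apply/negP => /forwardE. Qed.

Lemma limit_piece_uniq k l x : limit_piece k x -> limit_piece l x -> k = l.
Proof.
move=> /limit_piece_le0 kx /limit_piece_le0 lx; apply/eqP; apply: contraLR lx.
by move=> kl; rewrite -ltNge; apply: hom_disjoint kx.
Qed.

Lemma limit_set_piece x : limit_set S x -> exists k, limit_piece k x.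
Proof.
move=> Lx; have [k kx] := limit_set_inside Lx; exists k; split=> //.
by move=> /forwardE; rewrite ltNge (ltW kx).
Qed.

(** A limit point is interior to some disk, and disjointness forces that disk to be [k]. *)
Lemma limit_piece_lt0 k x : limit_piece k x -> qform k (hom x) < 0.
Proof.
move=> kx; have [Lx _] := kx; have [l lx] := limit_set_inside Lx.
suff -> : k = l by [].
by apply: limit_piece_uniq kx _; split=> // /forwardE; rewrite ltNge (ltW lx).
Qed.

(** This gives the time at which a geodesic crosses a side when the form has opposite signs at its
    two endpoints: [expR t ^+ 2 = - N / P]. *)
Lemma exp_root (P N : R) : P * N < 0 ->
  exists t, expR t * P + expR (- t) * N = 0.
Proof.
move=> PN; have P0 : P != 0 by apply: contraTneq PN => ->; rewrite mul0r ltxx.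
have q0 : 0 < - N / P.
  have -> : - N / P = - (P * N) / P ^+ 2 by field.
  by rewrite divr_gt0 ?oppr_gt0// exprn_even_gt0.
exists (ln (- N / P) / 2); set t := _ / 2.
have e0 := expR_gt0 t.
have tE : expR t ^+ 2 = - N / P.
  by rewrite -expRM_natl /t mulrCA divff ?mulr1 ?lnK.
rewrite expRN; apply: (mulfI (lt0r_neq0 e0)); rewrite mulr0 mulrDr !mulrA divff ?gt_eqF//.
by rewrite -expr2 tE divfK// mul1r addNr.
Qed.

(** Eliminating [N] turns the expression into [- P * (expR (t + t - s) - expR s)]. Thus a geodesic
    ending inside a disk is outside it exactly before the crossing time. *)
Lemma exp_root_gt0 (P N t s : R) : P < 0 ->
  expR t * P + expR (- t) * N = 0 ->
  (0 < expR s * P + expR (- s) * N) = (s < t).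
Proof.
move=> P0 /eqP; rewrite addrC addr_eq0 expRN => /eqP E.
have -> : N = - (expR t * (expR t * P)).
  by rewrite -mulrN -E mulrA divff ?mul1r// gt_eqF// expR_gt0.
have -> : expR s * P + expR (- s) * - (expR t * (expR t * P)) =
    - P * (expR (t + t - s) - expR s) by rewrite !expRD; ring.
by rewrite pmulr_rgt0 ?oppr_gt0// subr_gt0 ltr_expR; apply/idP/idP; lra.
Qed.

Lemma height_geo k g t : height (qform k) (g * geo t)%g =
  expR t * qform k (col1 g) + expR (- t) * qform k (col2 g).
Proof. by rewrite /height; have [-> ->] := form_geo g t (qform_scale k). Qed.

Lemma col1_geo_gt0 k g t :
  (0 < qform k (col1 (g * geo t)%g)) = (0 < qform k (col1 g)).
Proof. by rewrite !col1_gt0 P1_actM P1_act_geo. Qed.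

(** Between its start on a side and its entry into the disk [k], the geodesic
    stays in the common exterior of the disks. *)
Lemma strong_reps1_return g k :
  strong_reps1 S g -> limit_piece k (P1_act g None) ->
  exists t, [/\ 0 < t, strong_reps1 S (gen k * (g * geo t))%g &
    forall s h, 0 < s -> schottky_group S h ->
      reps1 S (h * (g * geo s))%g -> t <= s].
Proof.
move=> [/reps1E[a [a0 aP]] Lg] kg.
have kP : qform k (col1 g) < 0 by rewrite col1_lt0 limit_piece_lt0.
have ak : a != k by apply: contraTneq aP => ->; rewrite -leNgt ltW.
have kH : 0 < height (qform k) g by apply: height_disjoint ak _; rewrite a0.
(* The value at [g(oo)] is negative while its sum with the value at [g(0)] is positive, so the two
   have opposite signs. *)
have [|t tE] := @exp_root (qform k (col1 g)) (qform k (col2 g)).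
  by rewrite nmulr_rlt0//; move: kH kP; rewrite /height; lra.
have sgn s := exp_root_gt0 s kP tE.
have t0 : 0 < t.
  by rewrite -sgn oppr0 expR0 !mul1r.
exists t; split=> //.
  split; last first.
    rewrite !P1_actM P1_act_geo; apply: limit_set_act => //.
    exact: schottky_group_gen.
  (* At time [t] the geodesic is on the side [k] and heads into the disk; [gen k] moves it to the
     side [opp k], heading outwards. *)
  apply/reps1E; exists (opp k).
  have [c c0 [-> ->]] := gen_height k (g * geo t)%g.
  rewrite height_geo tE mulr0; split=> //.
  rewrite mulNr oppr_gt0 pmulr_rlt0//.
  by rewrite col1_lt0 P1_actM P1_act_geo -col1_lt0.
move=> s h s0 Gh; apply: contraPle => st.
apply: outside_not_reps1 => // m; rewrite height_geo.
have [->|mk] := eqVneq m k; first by rewrite sgn.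
have mP : 0 < qform m (col1 g).
  by apply: (@col1_disjoint _ _ k); rewrite ?(ltW kP)// eq_sym.
have mH : 0 <= height (qform m) g.
  have [<-|am] := eqVneq a m; first by rewrite a0.
  by apply/ltW/(height_disjoint am); rewrite a0.
have es : expR (- s) < expR s by rewrite ltr_expR; lra.
(* The height at time [s] combines the positive value at the endpoint with the nonnegative height at
   time 0, which vanishes on the starting side; both coefficients are positive for [s > 0]. *)
have -> : expR s * qform m (col1 g) + expR (- s) * qform m (col2 g) =
  (expR s - expR (- s)) * qform m (col1 g) + expR (- s) * height (qform m) g.
  by rewrite /height; ring.
apply: ltr_pwDl; first by rewrite mulr_gt0// subr_gt0.
by rewrite mulr_ge0// expR_ge0.
Qed.

(** If [x] is inside the disk [k], the geodesic from the centre of the different disk [opp k] to [x]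
    crosses the side [opp k] outwards. *)
Lemma strong_reps1_surj x : limit_set S x ->
  exists2 g, strong_reps1 S g & P1_act g None = x.
Proof.
move=> Lx; have [k kx] := limit_set_inside Lx.
have kk : k != opp k by case: (k) => i []; rewrite /opp xpair_eqE andbF.
move: (opp k) (hom_disjoint kk (ltW kx)) => l {kk}.
case: x Lx kx => [y|] Lx kx /= lx; last first.
  move: kx; rewrite /qform /disk_form /= expr0n /= !mulr0 !subr0 expr1n.
  by rewrite ltNge ler01.
set c := @Defs.center R S l; set r := @Defs.radius R S l.
have r0 : 0 < r := @radius_gt0 R S l.
have yc : y - c != 0.
  apply: contraTneq lx => yc; rewrite /qform /disk_form /= mulr1 yc.
  by rewrite expr0n expr1n mulr1 sub0r oppr_gt0 -leNgt ltW// exprn_gt0.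
(* This matrix sends infinity to [y] and 0 to the centre [c]. *)
have [|g [s [s1 E00 E01 E10 E11]]] :=
  @psl2_entries _ y (c / (y - c)) 1 (y - c)^-1.
  by rewrite mulr1 -mulrBl divff.
have s0 : s != 0.
  by apply: contra_eq_neq s1 => ->; rewrite expr0n eq_sym oner_neq0.
have gx : P1_act g None = Some y.
  rewrite /P1_act /= -/(entry g 1 0) -/(entry g 0 0) E10 E00 mulr1 (negPf s0).
  by rewrite mulrAC divff// mul1r.
have P0 : 0 < qform l (col1 g) by rewrite col1_gt0 gx.
have N0 : qform l (col2 g) < 0.
  have -> : qform l (col2 g) = s ^+ 2 * (- (r / (y - c)) ^+ 2).
    by rewrite /qform /disk_form /= E01 E11 -/c -/r; ring.
  rewrite s1 mul1r oppr_lt0 exprn_even_gt0//= mulf_neq0 ?invr_eq0//.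
  by rewrite gt_eqF.
have [|t tE] := @exp_root (qform l (col1 g)) (qform l (col2 g)).
  by rewrite pmulr_rlt0.
have gtx : P1_act (g * geo t)%g None = Some y by rewrite P1_actM P1_act_geo.
exists (g * geo t)%g => //; split; last by rewrite gtx.
by apply/reps1E; exists l; rewrite height_geo col1_geo_gt0.
Qed.

End Return.

(** * Products *)

Section ProductReturn.
Context {R : realType} {r : nat} (S : 'I_r -> schottky R).
Local Notation G := {ffun 'I_r -> PSL2 R}.
Implicit Types (g h : G) (t : 'I_r -> R) (x : 'I_r -> P1 R).
Implicit Types m : multi_index S.

Lemma Gamma1 : Gamma S 1%g.
Proof. by move=> j; rewrite ffunE; apply: schottky_group1. Qed.

Lemma GammaM g h : Gamma S g -> Gamma S h -> Gamma S (g * h)%g.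
Proof. by move=> Gg Gh j; rewrite ffunE; apply: schottky_groupM. Qed.

Lemma GammaV g : Gamma S g -> Gamma S g^-1%g.
Proof. by move=> Gg j; rewrite ffunE; apply: schottky_groupV. Qed.

Lemma Gamma_multi_gen m : Gamma S (multi_gen m).
Proof. by move=> j; rewrite ffunE; apply: schottky_group_gen. Qed.

Lemma coset_eqP g g' : coset S g = coset S g' <->
  exists2 h, Gamma S h & g = (h * g')%g.
Proof.
split=> [E|[h Gh ->]].
  have : coset S g g by exists 1%g; [exact: Gamma1|rewrite mul1g].
  by rewrite E => -[h Gh <-]; exists h.
apply/seteqP; split=> _ [k Gk <-]; rewrite ?mulgA.
  by exists (k * h)%g => //; apply: GammaM.
exists (k * h^-1)%g; last by rewrite -!mulgA mulKg.
by apply: GammaM => //; apply: GammaV.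
Qed.

Lemma flow_coset g t : flow (coset S g) t = coset S (g * flow_elt t)%g.
Proof.
apply/seteqP; split=> [_ [_ [h Gh <-] <-]|_ [h Gh <-]].
  by exists h; rewrite ?mulgA.
by exists (h * g)%g; [exists h|rewrite mulgA].
Qed.

(** The translating elements can be chosen independently in the factors, which makes membership a
    condition on each factor alone. *)
Lemma cross_section_coset g : cross_section S (coset S g) <->
  forall j, exists2 h, schottky_group (S j) h & reps1 (S j) (h * g j)%g.
Proof.
split=> [[g' rg' /coset_eqP[h Gh E]] j|H].
  exists (h j); first exact: Gh.
  by have := rg' j; rewrite E ffunE.
pose h j := projT1 (cid2 (H j)).
have Hh j : schottky_group (S j) (h j) /\ reps1 (S j) (h j * g j)%g.
  by rewrite /h; case: cid2.
have hE j : ([ffun j => h j] * g)%g j = (h j * g j)%g by rewrite !ffunE.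
exists ([ffun j => h j] * g)%g => [j|]; first by rewrite hE; have [] := Hh j.
apply/coset_eqP; exists [ffun j => h j] => // j.
by rewrite ffunE; have [] := Hh j.
Qed.

Lemma reps_inj g h : Gamma S h -> reps S g -> reps S (h * g)%g -> h = 1%g.
Proof.
move=> Gh rg rhg; apply/ffunP => j; rewrite [RHS]ffunE.
by apply: (reps1_inj (Gh j) (rg j)); have := rhg j; rewrite ffunE.
Qed.

Lemma strong_reps_reps g : strong_reps S g -> reps S g.
Proof. by move=> sg j; have [] := sg j. Qed.

Lemma first_return_unique v w w' :
  first_return S v w -> first_return S v w' -> w = w'.
Proof.
move=> [_ [t [_ tmin _] ->]] [_ [t' [_ tmin' _] ->]].
congr flow; apply/funext => j; have [Tt lt] := tmin j; have [Tt' lt'] := tmin' j.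
by apply/eqP; rewrite eq_le lt// lt'.
Qed.

(** First returns are unique as cosets, so two lifts differ by an element of [Gamma], which is
    trivial because [reps] injects into the quotient. *)
Lemma lifts_first_return_unique Rm Rm' g : lifts_first_return S Rm ->
  lifts_first_return S Rm' -> strong_reps S g -> Rm g = Rm' g.
Proof.
move=> H H' sg; have [sR fR] := H g sg; have [sR' fR'] := H' g sg.
have /coset_eqP[h Gh E] := first_return_unique fR fR'.
have h1 : h = 1%g.
  by apply: (reps_inj Gh (strong_reps_reps sR')); rewrite -E; apply: strong_reps_reps.
by rewrite E h1 mul1g.
Qed.

Lemma multi_piece_uniq m m' x : multi_piece m x -> multi_piece m' x -> m = m'.
Proof.
by move=> mx m'x; apply/ffunP => j; apply: limit_piece_uniq (mx j) (m'x j).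
Qed.

Lemma limit_set_multi_piece x :
  (forall j, limit_set (S j) (x j)) -> exists m, multi_piece m x.
Proof.
move=> Lx; pose k j := projT1 (cid (limit_set_piece (Lx j))).
exists [ffun j => k j] => j; rewrite ffunE /k.
by case: cid.
Qed.

Lemma boundary_domainP x :
  boundary_domain S x <-> forall j, limit_set (S j) (x j).
Proof.
split=> [[m _ mx] j|/limit_set_multi_piece[m mx]]; last by exists m.
by have [] := mx j.
Qed.

Lemma boundary_map_piece m x :
  multi_piece m x -> boundary_map S x = boundary_act (multi_gen m) x.
Proof.
move=> mx; rewrite /boundary_map; case: pickP => [m' /asboolP m'x|].
  by rewrite (multi_piece_uniq m'x mx).
by move=> /(_ m)/asboolP.
Qed.

Lemma boundary_map_domain :
  set_fun (boundary_domain S) (boundary_domain S) (boundary_map S).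
Proof.
move=> x [m _ mx]; rewrite (boundary_map_piece mx).
apply/boundary_domainP => j; rewrite /boundary_act ffunE.
by apply: limit_set_act; [exact: schottky_group_gen|have [] := mx j].
Qed.

Lemma boundary_domain_nu : boundary_domain S = @nu R r @` strong_reps S.
Proof.
apply/seteqP; split=> [x /boundary_domainP Lx|_ [g sg <-]]; last first.
  by apply/boundary_domainP => j; have [] := sg j.
pose g j := projT1 (cid2 (strong_reps1_surj (Lx j))).
have gP j : strong_reps1 (S j) (g j) /\ P1_act (g j) None = x j.
  by rewrite /g; case: cid2.
exists [ffun j => g j] => [j|]; first by rewrite ffunE; have [] := gP j.
by apply/funext => j; rewrite /nu ffunE; have [] := gP j.
Qed.

Lemma first_return_exists g m : strong_reps S g -> multi_piece m (nu g) ->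
  exists g', [/\ strong_reps S g', first_return S (coset S g) (coset S g') &
    nu g' = boundary_act (multi_gen m) (nu g)].
Proof.
move=> sg mg.
pose t j := projT1 (cid (strong_reps1_return (sg j) (mg j))).
have tP j : [/\ 0 < t j, strong_reps1 (S j) (gen (m j) * (g j * geo (t j)))%g &
    forall (s : R) (h : PSL2 R), 0 < s -> schottky_group (S j) h ->
      reps1 (S j) (h * (g j * geo s))%g -> t j <= s].
  by rewrite /t; case: cid.
have gtE s j : (g * flow_elt s)%g j = (g j * geo (s j))%g by rewrite !ffunE.
have E j : (multi_gen m * (g * flow_elt t))%g j =
    (gen (m j) * (g j * geo (t j)))%g by rewrite ffunE gtE ffunE.
(* The return times form a product over the factors, so the tuple of the one-factor minima is itself
   a return time. *)
have timesE s : return_times S (coset S g) s <-> forall j, 0 < s j /\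
    exists2 h, schottky_group (S j) h & reps1 (S j) (h * (g j * geo (s j)))%g.
  rewrite /return_times /= flow_coset cross_section_coset.
  split=> [[s0 H] j|H].
    by split=> //; have := H j; rewrite gtE.
  by split=> j; have [? ?] := H j; rewrite ?gtE.
have tT : return_times S (coset S g) t.
  apply/timesE => j; have [t0 [rt _] _] := tP j; split=> //.
  by exists (gen (m j)) => //; apply: schottky_group_gen.
exists (multi_gen m * (g * flow_elt t))%g; split.
- by move=> j; rewrite E; have [] := tP j.
- split; first by exists g => //; apply: strong_reps_reps.
  exists t; last first.
    rewrite flow_coset; apply/coset_eqP; exists (multi_gen m) => //.
    exact: Gamma_multi_gen.
  split=> //; first by exists t.
  move=> j; split; first by exists t.
  move=> _ [s /timesE/(_ j)[s0 [h Gh rh]] <-].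
  by have [_ _] := tP j; apply; [exact: s0|exact: Gh|].
- apply/funext => j; rewrite /nu /boundary_act E ffunE.
  by rewrite !P1_actM P1_act_geo.
Qed.

Lemma lifts_first_return_exists : exists2 Rm, lifts_first_return S Rm &
  forall g m, strong_reps S g -> multi_piece m (nu g) ->
    nu (Rm g) = boundary_act (multi_gen m) (nu g).
Proof.
have H g : exists g', strong_reps S g ->
    [/\ strong_reps S g', first_return S (coset S g) (coset S g') &
    forall m, multi_piece m (nu g) ->
      nu g' = boundary_act (multi_gen m) (nu g)].
  (* Outside [strong_reps] the lift is unconstrained and is taken to be the identity. *)
  have [sg|nsg] := pselect (strong_reps S g); last by exists g.
  have [m mg] : exists m, multi_piece m (nu g).
    by apply: limit_set_multi_piece => j; have [] := sg j.
  have [g' [sg' fg' E]] := first_return_exists sg mg.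
  by exists g' => _; split=> // m' /(multi_piece_uniq mg) <-.
have [Rm HRm] := choice H; exists Rm => [g sg|g m sg].
  by have [] := HRm g sg.
by have [_ _] := HRm g sg; apply.
Qed.

Lemma boundary_map_induced : induced_system S (boundary_map S).
Proof.
split; first by rewrite -boundary_domain_nu; apply: boundary_map_domain.
have [Rm HRm E] := lifts_first_return_exists.
exists Rm => // g sg; have [m mg] : exists m, multi_piece m (nu g).
  by apply: limit_set_multi_piece => j; have [] := sg j.
by rewrite (boundary_map_piece mg) (E g m).
Qed.

(** Every point of the domain is [nu g] for some [g] in [strong_reps], and the lift of the first
    return is unique there. Hence an induced system is determined on its domain, which also
    identifies the one-factor systems. *)
Lemma induced_system_piece Phi m x : induced_system S Phi ->
  multi_piece m x -> Phi x = boundary_act (multi_gen m) x.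
Proof.
move=> [_ [Rm HRm E]] mx.
have [g sg gx] : (@nu R r @` strong_reps S) x.
  by rewrite -boundary_domain_nu; exists m.
have [Rm' HRm' E'] := lifts_first_return_exists.
rewrite -gx E// (lifts_first_return_unique HRm HRm' sg) (E' g m)//.
by rewrite gx.
Qed.

End ProductReturn.

(** * A single factor as the case [r = 1] *)

Section OneFactor.
Context {R : realType} (S : schottky R).

Lemma induced_system1_piece f (k : side_index S) (x : P1 R) :
  induced_system1 S f -> limit_piece k x -> f x = P1_act (gen k) x.
Proof.
move=> [_ If] kx.
pose m : multi_index (fun _ : 'I_1 => S) := [ffun _ => k].
have mx : multi_piece m (fun=> x) by move=> j; rewrite ffunE.
have := congr1 (fun F => F ord0) (induced_system_piece If mx).
by rewrite /boundary_act !ffunE.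
Qed.

Lemma induced_system1_exists : exists f, induced_system1 S f.
Proof.
pose F := boundary_map (fun _ : 'I_1 => S).
exists (fun x => F (fun=> x) ord0); split.
  move=> x Lx; have D : boundary_domain (fun _ : 'I_1 => S) (fun=> x).
    exact/boundary_domainP.
  by have /boundary_domainP := boundary_map_domain D; apply.
(* A function on ['I_1] is constant, so evaluating at [ord0] and extending back changes nothing. *)
suff -> : (fun x j => F (fun=> x j) ord0) = F by apply: boundary_map_induced.
apply/funext => x; apply/funext => j.
rewrite (ord1 j); congr (F _ ord0).
by apply/funext => i; rewrite (ord1 i).
Qed.

End OneFactor.

Theorem theorem5p1 (R : realType) (r : nat) (S : 'I_r -> schottky R) :
  (* F is a well-defined self-map of D *)
  ((forall (m : multi_index S) (x : 'I_r -> P1 R), multi_piece m x ->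
      boundary_map S x = boundary_act (multi_gen m) x) /\
   set_fun (boundary_domain S) (boundary_domain S) (boundary_map S)) /\
  (* (i) *)
  (boundary_domain S = @nu R r @` strong_reps S /\
   induced_system S (boundary_map S)) /\
  (* (ii) *)
  ((forall j, exists f : P1 R -> P1 R, induced_system1 (S j) f) /\
   (forall f : 'I_r -> P1 R -> P1 R,
      (forall j, induced_system1 (S j) (f j)) ->
      forall (m : multi_index S) (x : 'I_r -> P1 R), multi_piece m x ->
        boundary_map S x = (fun j => f j (x j)))).
Proof.
split; first by split; [exact: boundary_map_piece|exact: boundary_map_domain].
split; first by split; [exact: boundary_domain_nu|exact: boundary_map_induced].
split=> [j|f If m x mx]; first exact: induced_system1_exists.
rewrite (boundary_map_piece mx); apply/funext => j.
by rewrite (induced_system1_piece (If j) (mx j)) /boundary_act ffunE.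
Qed.
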